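(* Let $p$ be a prime and let $\chi:\mathbb{Z}\to\overline{\mathbb{Q}}_p$ be a primitive Dirichlet character of conductor $f>1$ with $f$ prime to $p$. Then for every integer $N>0$ prime to $p$ and divisible by $f$, and every integer $r$, \[ L_p(r,\chi\omega^{1-r})=-\frac{1}{N^r}\sum_{k=1}^{N-1}\chi(k)\,\widetilde{\psi}^{(r-1)}_p(k/N). \]
   Context: For an integer $r$, $\widetilde{\psi}_p^{(r)}(z):=\lim_{n\in\mathbb{Z}_{>0},\,n\to z}\sum_{0<k<n,\ p\nmid k}k^{-(r+1)}$ for $z\in\mathbb{Z}_p$ (the $p$-adic polygamma function; the limit is $p$-adic). $\omega$ denotes the Teichmüller character and $L_p(s,\psi)$ the Kubota–Leopoldt $p$-adic $L$-function of a Dirichlet character $\psi$. *)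

(* Defs.v *)
From HB Require Import structures.
From mathcomp Require Import all_boot all_order all_algebra.
From mathcomp Require Import all_classical all_reals all_analysis.

Set Implicit Arguments.
Unset Strict Implicit.
Unset Printing Implicit Defensive.

Import Order.TTheory GRing.Theory Num.Theory.

Local Open Scope classical_set_scope.
Local Open Scope ring_scope.

Definition rat_closure (R : realType) (F : unitRingType) (v : F -> R) : set F :=
  [set x | forall e, 0 < e -> exists q : rat, v (x - ratr q) < e].

(* An algebraic closure of the p-adic numbers with its p-adic absolute value:
   an algebraically closed field K with a multiplicative ultrametric absolute
   value normalized by |p| = 1/p, such that the closure of the rationals in K
   (a copy of Q_p) is complete and K is algebraic over it.  For p prime these
   axioms determine K up to isometric isomorphism.  The absolute value cannot
   be a MathComp norm, because normedZmodType requires `|x *+ n| = `|x| *+ n. *)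
HB.mixin Record isPadicClosure (R : realType) (p : nat) K
    of GRing.ClosedField K := {
  pabs : K -> R ;
  pabs_ge0 : forall x, 0 <= pabs x ;
  pabs_eq0 : forall x, pabs x = 0 <-> x = 0 ;
  pabsM : forall x y, pabs (x * y) = pabs x * pabs y ;
  pabsD_max : forall x y, pabs (x + y) <= Num.max (pabs x) (pabs y) ;
  pabs_p : pabs p%:R = p%:R^-1 ;
  rat_closure_complete : forall u : nat -> K,
    (forall n, rat_closure pabs (u n)) ->
    (forall e, 0 < e -> exists M : nat, forall m n : nat,
       (M <= m)%N -> (M <= n)%N -> pabs (u m - u n) < e) ->
    exists l : K, forall e, 0 < e -> exists M : nat, forall n : nat,
       (M <= n)%N -> pabs (u n - l) < e ;
  algebraic_over_rat_closure : forall x : K, exists q : {poly K},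
    [/\ q != 0, root q x & forall i, rat_closure pabs q`_i]
}.

#[short(type="padicClosureType")]
HB.structure Definition PadicClosure (R : realType) (p : nat) :=
  {K of GRing.ClosedField K & isPadicClosure R p K}.

Section PadicTopology.
Variables (R : realType) (p : nat) (K : padicClosureType R p).
Implicit Types x y z : K.

Let dist x y := pabs (x - y).

Let distxx x : dist x x = 0.
Proof. by rewrite /dist subrr; apply/pabs_eq0. Qed.

Let dist_eq0 x y : dist x y = 0 -> x = y.
Proof. by move=> /pabs_eq0/eqP; rewrite subr_eq0 => /eqP. Qed.

Let dist_sym x y : dist x y = dist y x.
Proof.
have v1 : pabs (1 : K) = 1.
  have := pabsM (1 : K) 1; rewrite mulr1 => /esym/eqP.
  rewrite -{3}[pabs 1]mulr1 -subr_eq0 -mulrBr mulf_eq0 subr_eq0.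
  by case/orP => /eqP // /pabs_eq0/eqP; rewrite oner_eq0.
have vN1 : pabs (-1 : K) = 1.
  apply/eqP; rewrite -(@eqrXn2 _ 2) ?pabs_ge0 ?ler01 //.
  by rewrite expr1n expr2 -pabsM mulrNN mulr1 v1.
by rewrite /dist -opprB -mulN1r pabsM vN1 mul1r.
Qed.

Let dist_triangle y x z : dist x z <= dist x y + dist y z.
Proof.
rewrite /dist -(subrK y x) -[X in pabs X]addrA subrK.
apply: le_trans (pabsD_max _ _) _.
by rewrite ge_max lerDl lerDr !pabs_ge0.
Qed.

HB.instance Definition _ := isPointed.Build K 0.
HB.instance Definition _ :=
  isMetric.Build R K distxx dist_eq0 dist_sym dist_triangle.

End PadicTopology.

Definition padic_int (R : realType) (p : nat) (K : padicClosureType R p) :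
    set K :=
  closure (range (fun m : int => m%:~R : K)).

Arguments padic_int {R p} K _.

(* The filter "n -> z, n a positive integer", for the p-adic topology. *)
Definition posint_nbhs (R : realType) (p : nat) (K : padicClosureType R p)
    (z : K) : set_system nat :=
  [set A | \forall y \near z, forall n : nat, (0 < n)%N -> n%:R = y -> A n].

Definition padic_polygamma (R : realType) (p : nat) (K : padicClosureType R p)
    (r : int) (z : K) : K :=
  lim ((\sum_(1 <= k < n | ~~ (p %| k)%N) (k%:R : K) ^ (- (r + 1)))
         @[n --> posint_nbhs z]).

(* A primitive Dirichlet character of conductor f, extended by zero to the
   integers not prime to f. *)
Record primitive_dirichlet (K : fieldType) (f : nat) (chi : int -> K) : Prop :=
  PrimitiveDirichlet {
    dirichlet_cond_gt0 : (0 < f)%N ;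
    dirichlet_periodic : forall a, chi (a + f%:Z) = chi a ;
    dirichletM : forall a b, chi (a * b) = chi a * chi b ;
    dirichlet_neq0 : forall a, (chi a != 0) = coprimez a f%:Z ;
    dirichlet_primitive : forall d, (d %| f)%N -> (d < f)%N ->
      exists a, [/\ coprimez a f%:Z, (a = 1 %[mod d%:Z])%Z & chi a <> 1]
  }.

Definition conductor (K : fieldType) (chi : int -> K) : nat :=
  get [set f | primitive_dirichlet f chi].

Definition teich_modulus (p : nat) : nat := if p == 2%N then 4%N else p.

Definition teichmuller (R : realType) (p : nat) (K : padicClosureType R p)
    (a : int) : K :=
  if (p %| a)%Z then 0 else
  get [set x : K | x ^+ totient (teich_modulus p) = 1 /\
                   pabs (x - a%:~R) <= pabs ((teich_modulus p)%:R : K)].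

(* The character chi omega^j, in the usual sense of the primitive character
   inducing the pointwise product. *)
Definition teich_twist (R : realType) (p : nat) (K : padicClosureType R p)
    (chi : int -> K) (j : int) : int -> K :=
  get [set phi : int -> K |
    (exists c, primitive_dirichlet c phi) /\
    forall a, ~~ (p %| a)%Z -> chi a != 0 ->
      phi a = chi a * teichmuller K a ^ j].

Fixpoint bernoulli_seq (n : nat) : seq rat :=
  if n is m.+1 then
    let s := bernoulli_seq m in
    rcons s ((m == 0%N)%:R - (\sum_(k < m) 'C(m.+1, k)%:R * s`_k) / m.+1%:R)
  else [::].

Definition bernoulli_number (n : nat) : rat := (bernoulli_seq n.+1)`_n.

Lemma bernoulli_number_rec (n : nat) :
  \sum_(k < n.+1) 'C(n.+1, k)%:R * bernoulli_number k = (n == 0%N)%:R.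
Proof.
have sz m : size (bernoulli_seq m) = m by elim: m => //= m IH; rewrite size_rcons IH.
have nthE m k : (k < m)%N -> (bernoulli_seq m)`_k = bernoulli_number k.
  elim: m => // m IH; rewrite ltnS leq_eqVlt => /orP[/eqP-> //|km].
  by rewrite /= nth_rcons sz km IH.
rewrite big_ord_recr /= {2}/bernoulli_number /= nth_rcons sz ltnn eqxx.
under [X in _ - X / _]eq_bigr => k _ do rewrite nthE //.
rewrite binSn mulrBr mulrCA divff ?pnatr_eq0 // mulr1 addrCA subrr addr0.
by case: n => [|n]; rewrite ?mulr1 ?mulr0.
Qed.

Definition bernoulli_poly (n : nat) : {poly rat} :=
  \sum_(k < n.+1) ('C(n, k)%:R * bernoulli_number k) *: 'X^(n - k).

(* B_{n,chi}, where sum_{a=1}^F chi(a) t e^{at} / (e^{Ft} - 1)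
   = sum_n B_{n,chi} t^n / n! with F the conductor of chi, in the form
   B_{n,chi} = F^(n-1) sum_{a=1}^F chi(a) B_n(a/F). *)
Definition gen_bernoulli (K : fieldType) (n : nat) (chi : int -> K) : K :=
  let F := conductor chi in
  F%:R ^ (n%:Z - 1) *
  \sum_(1 <= a < F.+1)
     chi a%:Z * (map_poly ratr (bernoulli_poly n)).[a%:R / F%:R].

(* L is the Kubota-Leopoldt p-adic L-function s |-> L_p(s, psi) on Z_p (minus
   its pole s = 1 when psi is trivial): the continuous function such that
   L(1 - n) = - (1 - (psi omega^-n)(p) p^(n-1)) B_{n, psi omega^-n} / n
   for all n >= 1. *)
Definition kubota_leopoldt (R : realType) (p : nat) (K : padicClosureType R p)
    (psi : int -> K) (L : K -> K) : Prop :=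
  {within padic_int K `&` [set s | psi = (fun=> 1) -> s <> 1], continuous L} /\
  forall n : nat, (0 < n)%N ->
    let psin := teich_twist psi (- n%:Z) in
    L (1 - n%:R) =
      - (1 - psin p%:Z * p%:R ^+ n.-1) * (gen_bernoulli n psin / n%:R).

(* Main.v *)
(* For n > 0 with n - 1 = -r + phi(p^(j+1)) t, the powers l^(n-1) approximate l^(-r)
   within p^(-j) for all l prime to p.  If phi(q) divides t (q = 4 for p = 2, and
   q = p otherwise), then the n-th twist of chi omega^(1-r) is chi itself, so
   L(1 - n) = - (1 - chi(p) p^(n-1)) B_(n,chi) / n.  On the other side, the
   polygamma value at k/N is within p^(-j) of the limit of the power sums
   sum_(l < x, p not dividing l) l^(n-1) as x -> k/N, which the relation
   P(x+1) - P(x) = n x^(n-1) for the Bernoulli polynomial P evaluates as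
   (P(k/N) - P(0)) / n - p^(n-1) (P(u/N) - P(0)) / n with p u = k mod N.  Summing
   against chi gives N^(1-n) (1 - chi(p) p^(n-1)) B_(n,chi) / n.  Letting j grow,
   1 - n tends to r, and the continuity of L concludes. *)

From HB Require Import structures.
Require Import Defs.
From mathcomp Require Import all_boot all_order all_algebra all_solvable.
From mathcomp Require Import all_classical all_reals all_analysis.
From mathcomp Require Import ring.

Set Implicit Arguments.
Unset Strict Implicit.
Unset Printing Implicit Defensive.

Import Order.TTheory GRing.Theory Num.Theory.

Local Open Scope classical_set_scope.
Local Open Scope ring_scope.

(** * The p-adic absolute value *)

Section PadicAbs.
Variables (R : realType) (p : nat) (K : padicClosureType R p).
Hypothesis hp : prime p.
Implicit Types x y z : K.

Lemma pabs0 : pabs (0 : K) = 0.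
Proof. exact/pabs_eq0. Qed.

Lemma pabs1 : pabs (1 : K) = 1.
Proof.
have := pabsM (1 : K) 1; rewrite mulr1 => /esym/eqP.
rewrite -{3}[pabs 1]mulr1 -subr_eq0 -mulrBr mulf_eq0 subr_eq0.
by case/orP => /eqP // /pabs_eq0/eqP; rewrite oner_eq0.
Qed.

Lemma pabsX x n : pabs (x ^+ n) = pabs x ^+ n.
Proof. by elim: n => [|n IH]; rewrite ?pabs1 // !exprS pabsM IH. Qed.

Lemma pabs_neq0 x : x != 0 -> pabs x != 0.
Proof. by move/eqP=> x0; apply/eqP => /pabs_eq0. Qed.

Lemma pabs_gt0 x : x != 0 -> 0 < pabs x.
Proof. by move=> x0; rewrite lt_def pabs_neq0 // pabs_ge0. Qed.

Lemma pabsV x : pabs x^-1 = (pabs x)^-1.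
Proof.
have [->|x0] := eqVneq x 0; first by rewrite invr0 pabs0 invr0.
by apply: (mulfI (pabs_neq0 x0)); rewrite -pabsM !divff ?pabs1 ?pabs_neq0.
Qed.

Lemma pabs_eq1_neq0 x : pabs x = 1 -> x != 0.
Proof.
by move=> x1; apply: contra_eqN x1 => /eqP ->; rewrite pabs0 eq_sym oner_neq0.
Qed.

Lemma pabs_expr_eq1 x n : (0 < n)%N -> pabs x ^+ n = 1 -> pabs x = 1.
Proof. by move=> n0 /eqP; rewrite pexpr_eq1 ?pabs_ge0 // => /eqP. Qed.

Lemma pabsN x : pabs (- x) = pabs x.
Proof.
suff N1 : pabs (- 1 : K) = 1 by rewrite -mulN1r pabsM N1 mul1r.
by apply: (@pabs_expr_eq1 _ 2) => //; rewrite -pabsX sqrrN expr1n pabs1.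
Qed.

Lemma pabsC x y : pabs (x - y) = pabs (y - x).
Proof. by rewrite -pabsN opprB. Qed.

Lemma pabsD_le x y e : pabs x <= e -> pabs y <= e -> pabs (x + y) <= e.
Proof. by move=> xe ye; rewrite (le_trans (pabsD_max _ _)) // ge_max xe. Qed.

Lemma pabsB_le x y e : pabs x <= e -> pabs y <= e -> pabs (x - y) <= e.
Proof. by move=> xe ye; rewrite pabsD_le // pabsN. Qed.

Lemma pabsD_lt x y e : pabs x < e -> pabs y < e -> pabs (x + y) < e.
Proof. by move=> xe ye; rewrite (le_lt_trans (pabsD_max _ _)) // gt_max xe. Qed.

Lemma pabs_trans y x z e :
  pabs (x - y) <= e -> pabs (y - z) <= e -> pabs (x - z) <= e.
Proof. by move=> xy yz; rewrite -(subrK y x) -addrA pabsD_le. Qed.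

Lemma pabs_sum_le (I : Type) (s : seq I) (P : pred I) (F : I -> K) e :
  0 <= e -> (forall i, P i -> pabs (F i) <= e) ->
  pabs (\sum_(i <- s | P i) F i) <= e.
Proof.
move=> e0 Fe; elim/big_ind: _ => //; first by rewrite pabs0.
by move=> x y; apply: pabsD_le.
Qed.

Lemma pabs_nat_le1 n : pabs (n%:R : K) <= 1.
Proof.
elim: n => [|n IH]; first by rewrite pabs0 ler01.
by rewrite -addn1 natrD pabsD_le // pabs1.
Qed.

Lemma pabs_int_le1 (m : int) : pabs (m%:~R : K) <= 1.
Proof. by case: m => n; rewrite ?NegzE ?mulrNz ?pabsN; apply: pabs_nat_le1. Qed.

Lemma pinv_gt0 : 0 < (p%:R : R)^-1.
Proof. by rewrite invr_gt0 ltr0n prime_gt0. Qed.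

Lemma pinv_lt1 : (p%:R : R)^-1 < 1.
Proof. by rewrite invf_lt1 ?ltr0n ?prime_gt0 // ltr1n prime_gt1. Qed.

Lemma pinvX_ge0 n : 0 <= (p%:R : R)^-1 ^+ n.
Proof. by rewrite exprn_ge0 // ltW // pinv_gt0. Qed.

Lemma pinvX_le m n : (m <= n)%N -> (p%:R : R)^-1 ^+ n <= p%:R^-1 ^+ m.
Proof. by move=> mn; rewrite ler_wiXn2l ?ltW ?pinv_lt1 ?pinv_gt0. Qed.

Lemma pinvX_lt (e : R) : 0 < e -> exists n, (p%:R : R)^-1 ^+ n < e.
Proof.
move=> e0; have [n /= hn] : exists n, (e^-1 < (n%:R : R)).
  by exists (Num.bound e^-1); rewrite archi_boundP // invr_ge0 ltW.
exists n; rewrite exprVn -[e]invrK ltf_pV2 ?posrE ?exprn_gt0 ?ltr0n ?prime_gt0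
  ?invr_gt0 //.
apply: lt_trans hn _; rewrite -natrX ltr_nat; apply: ltn_expl; exact: prime_gt1.
Qed.

Lemma pabs_expp M : pabs (p%:R ^+ M : K) = p%:R^-1 ^+ M.
Proof. by rewrite pabsX pabs_p. Qed.

Lemma pabs_dvdz (m : int) M :
  (p%:Z ^+ M %| m)%Z -> pabs (m%:~R : K) <= p%:R^-1 ^+ M.
Proof.
case/dvdzP=> c ->; rewrite intrM pabsM rmorphXn /= pabs_expp.
by rewrite ler_piMl ?pinvX_ge0 // pabs_int_le1.
Qed.

Lemma pabs_coprime (m : int) : ~~ (p %| m)%Z -> pabs (m%:~R : K) = 1.
Proof.
move=> pm; apply/eqP; rewrite eq_le pabs_int_le1 leNgt; apply/negP => m1.
have /coprimezP [[u v] /= uv] : coprimez m p%:Z.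
  by rewrite coprimez_sym coprimezE /= prime_coprime.
have := pabs1; rewrite -[1]/(1%:~R) -uv rmorphD !rmorphM /= => e.
have : (pabs (u%:~R * m%:~R + v%:~R * p%:Z%:~R : K) < 1).
  apply: pabsD_lt; rewrite pabsM.
    by rewrite (le_lt_trans _ m1) // ler_piMl ?pabs_ge0 // pabs_int_le1.
  have pV0 := ltW pinv_gt0.
  by rewrite pabs_p (le_lt_trans _ pinv_lt1) // ler_piMl // pabs_int_le1.
by rewrite e ltxx.
Qed.

Lemma pabs_nat_coprime m : ~~ (p %| m)%N -> pabs (m%:R : K) = 1.
Proof. by move=> pm; rewrite -(pabs_coprime (m := m%:Z)). Qed.

Lemma pabs_lt_dvdz (m : int) M :
  pabs (m%:~R : K) < p%:R^-1 ^+ M -> (p%:Z ^+ M.+1 %| m)%Z.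
Proof.
elim: M m => [|M IH] m.
  by rewrite expr0 expr1; apply: contraTT => /pabs_coprime ->; rewrite ltxx.
move=> lt_m; have /IH := lt_le_trans lt_m (pinvX_le (leqnSn M)).
rewrite exprS => /(dvdz_trans (dvdz_mulr _ (dvdzz _))) /dvdzP [c mE].
rewrite exprS mulrC mE dvdz_mul2r ?eqz_nat -?lt0n ?prime_gt0 //.
by apply: IH; move: lt_m; rewrite mE intrM pabsM pabs_p exprSr ltr_pM2r ?pinv_gt0.
Qed.

Lemma padic_nat_neq0 n : (0 < n)%N -> n%:R != 0 :> K.
Proof.
move=> n0; apply/eqP => nK0.
have := @pabs_lt_dvdz n%:Z n; rewrite /= -pmulrn nK0 pabs0 exprn_gt0 ?pinv_gt0 //.
move=> /(_ isT); rewrite dvdzE abszX /= => /dvdn_leq -/(_ n0).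
by rewrite leqNgt (ltn_trans (ltn_expl n (prime_gt1 hp))) // ltn_exp2l ?prime_gt1.
Qed.

Lemma pabs_unit_expz x (m : int) : pabs x = 1 -> pabs (x ^ m) = 1.
Proof. by case: m => n x1; rewrite ?NegzE -?exprnN ?pabsV pabsX x1 expr1n ?invr1. Qed.

Lemma pabs_exprB x y n : pabs x <= 1 -> pabs y <= 1 ->
  pabs (x ^+ n - y ^+ n) <= pabs (x - y).
Proof.
move=> x1 y1; rewrite subrXX pabsM ler_piMr ?pabs_ge0 //.
apply: pabs_sum_le => // i _; rewrite pabsM !pabsX.
by rewrite mulr_ile1 ?exprn_ge0 ?exprn_ile1 ?pabs_ge0.
Qed.

Lemma pabs_exprzB x y (m : int) : pabs x = 1 -> pabs y = 1 ->
  pabs (x ^ m - y ^ m) <= pabs (x - y).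
Proof.
move=> x1 y1; case: m => n; first by rewrite pabs_exprB ?x1 ?y1.
rewrite NegzE -!exprnN.
have -> : x ^- n.+1 - y ^- n.+1 = (y ^+ n.+1 - x ^+ n.+1) / (x ^+ n.+1 * y ^+ n.+1).
  by field; rewrite !expf_neq0 ?pabs_eq1_neq0.
by rewrite pabsM pabsV pabsM !pabsX x1 y1 !expr1n mulr1 invr1 mulr1 pabsC pabs_exprB
  ?x1 ?y1.
Qed.

Lemma pabs_hornerB (P : {poly K}) : exists2 C : R, 0 <= C &
  forall x y, pabs x <= 1 -> pabs y <= 1 ->
    pabs (P.[x] - P.[y]) <= C * pabs (x - y).
Proof.
exists (\sum_(i < size P) pabs P`_i) => [|x y x1 y1];
  first by apply: sumr_ge0 => i _; apply: pabs_ge0.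
rewrite !horner_coef -sumrB; apply: pabs_sum_le => [|i _].
  by rewrite mulr_ge0 ?pabs_ge0 // sumr_ge0 // => i _; apply: pabs_ge0.
rewrite -mulrBr pabsM ler_pM ?pabs_ge0 ?pabs_exprB //.
by rewrite (bigD1 i) //= lerDl sumr_ge0 // => j _; apply: pabs_ge0.
Qed.

Lemma nbhs_padicP (x : K) (A : set K) :
  nbhs x A <-> exists2 e : R, 0 < e & forall y, pabs (x - y) < e -> A y.
Proof.
by rewrite -nbhs_ballE; split => [[e /= e0 xA]|[e e0 xA]]; exists e.
Qed.

End PadicAbs.

(** * Primitive Dirichlet characters *)

Lemma coprimez_modP (a b d : int) :
  (a = b %[mod d])%Z -> coprimez a d = coprimez b d.
Proof. by move=> ab; rewrite /coprimez -gcdz_modl ab gcdz_modl. Qed.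

Lemma coprimez_shift (a l : int) (M : nat) : (0 < M)%N -> coprimez a l ->
  exists t : int, coprimez (a + l * t) M%:Z.
Proof.
move=> M0 cal.
(* [t] is the product of the primes of [M] that do not divide [a]. *)
pose t := (\prod_(q <- primes M | ~~ (q%:Z %| a)%Z) q)%N.
have qt q : prime q -> (q %| M)%N -> (q %| t)%N = ~~ (q%:Z %| a)%Z.
  move=> pq qM; apply/idP/idP => [|qa].
    rewrite /t Euclid_dvd_prod // big_has_cond => /hasP[q'].
    by rewrite mem_primes => /and3P[pq' _ _] /andP[q'a];
      rewrite dvdn_prime2 // => /eqP ->.
  have qP : q \in primes M by rewrite mem_primes pq M0.
  by rewrite /t (big_rem q) //= qa dvdn_mulr.
exists t%:Z; rewrite coprimezE /=; apply/negPn/negP => ncop.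
have [q pq] : exists2 q, prime q & (q %| gcdn (absz (a + l * t%:Z)%R) M)%N.
  exists (pdiv (gcdn (absz (a + l * t%:Z)%R) M)); last exact: pdiv_dvd.
  apply: pdiv_prime; rewrite ltn_neqAle eq_sym ncop gcdn_gt0 M0 orbT //.
rewrite dvdn_gcd => /andP[qs qM].
have {}qs : (q%:Z %| a + l * t%:Z)%Z by [].
have [qa|qa] := boolP (q%:Z %| a)%Z; last first.
  by move: qs; rewrite rpredDr ?(negPf qa) // dvdz_mull // dvdzE /= qt.
have cql : coprimez q%:Z l.
  by apply: coprimez_dvdl cal; move: qa; rewrite dvdzE.
by move: qs; rewrite rpredDl // (Gauss_dvdzr _ cql) dvdzE /= qt // qa.
Qed.

Lemma sum_modz_mull (V : nmodType) (f : nat) (F : int -> V) (b : int) :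
  (0 < f)%N -> coprimez b f%:Z ->
  (forall x y, (x = y %[mod f%:Z])%Z -> F x = F y) ->
  \sum_(i < f) F (b * (i : nat)%:Z) = \sum_(i < f) F (i : nat)%:Z.
Proof.
move=> f0 cb Fmod; have fz : f%:Z != 0 by rewrite eqz_nat -lt0n.
pose res x := absz (x %% f%:Z)%Z.
have resE x : (res x)%:Z = (x %% f%:Z)%Z by rewrite gez0_abs ?modz_ge0.
have res_lt x : (res x < f)%N by rewrite -ltz_nat resE ltz_pmod.
have inj : injective (fun i : 'I_f => Ordinal (res_lt (b * (i : nat)%:Z))).
  move=> i j /(congr1 (fun k : 'I_f => (k : nat)%:Z)) /=; rewrite !resE => /eqP.
  rewrite eqz_mod_dvd -mulrBr Gauss_dvdzr 1?coprimez_sym // -eqz_mod_dvd.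
  by rewrite !modz_nat !modn_small // eqz_nat => /eqP/val_inj.
rewrite [RHS](reindex_inj inj); apply: eq_bigr => i _ /=.
by apply: Fmod; rewrite resE modz_mod.
Qed.

Section Primitive.
Variables (K : fieldType).
Implicit Types (chi : int -> K) (f g M : nat).

Lemma dirichlet_modz f chi : primitive_dirichlet f chi ->
  forall a b, (a = b %[mod f%:Z])%Z -> chi a = chi b.
Proof.
move=> hchi.
have per a (n : nat) : chi (a + n%:Z * f%:Z) = chi a.
  elim: n => [|n IH]; first by rewrite mul0r addr0.
  by rewrite intS mulrDl mul1r addrCA addrC (dirichlet_periodic hchi).
have perz a (n : int) : chi (a + n * f%:Z) = chi a.
  case: n => n //; rewrite NegzE mulNr.
  by rewrite -[LHS](per _ n.+1) subrK.
move=> a b /eqP; rewrite eqz_mod_dvd => /dvdzP[c abc].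
by rewrite -(subrK b a) abc addrC perz.
Qed.

Lemma dirichlet1 f chi : primitive_dirichlet f chi -> chi 1 = 1.
Proof.
move=> hchi; have := dirichletM hchi 1 1; rewrite mulr1 => /esym/eqP.
rewrite -{3}[chi 1]mulr1 -subr_eq0 -mulrBr mulf_eq0 subr_eq0.
case/orP => /eqP // chi10; have := dirichlet_neq0 hchi 1.
by rewrite chi10 eqxx /coprimez gcd1z eqxx.
Qed.

Lemma dirichlet_eq0 f chi : primitive_dirichlet f chi ->
  forall a, ~~ coprimez a f%:Z -> chi a = 0.
Proof. by move=> hchi a; rewrite -(dirichlet_neq0 hchi) negbK => /eqP. Qed.

Lemma dirichlet_coprime_repr f (a : int) M : (0 < M)%N -> coprimez a f%:Z ->
  exists2 b : int, (b = a %[mod f%:Z])%Z & coprimez b M%:Z.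
Proof.
move=> M0 /(coprimez_shift M0)[t ct]; exists (a + f%:Z * t) => //.
by rewrite addrC mulrC modzMDl.
Qed.

(* [chi1] is trivial on the residues that are 1 mod [gcdn f1 f2]: such a residue
   lifts to one that is 1 mod [f2], where [chi1] agrees with [chi2]. *)
Lemma primitive_conductor_dvd f1 f2 chi1 chi2 M : (0 < M)%N ->
  primitive_dirichlet f1 chi1 -> primitive_dirichlet f2 chi2 ->
  (forall a, coprimez a M%:Z -> coprimez a f1%:Z -> coprimez a f2%:Z ->
     chi1 a = chi2 a) -> (f1 %| f2)%N.
Proof.
move=> M0 h1 h2 chi12; have f1_gt0 := dirichlet_cond_gt0 h1.
suff : gcdn f1 f2 = f1 by move=> <-; rewrite dvdn_gcdr.
apply/eqP; rewrite eqn_leq dvdn_leq ?dvdn_gcdl //= leqNgt; apply/negP => glt.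
have [a [ca a1 chia]] := dirichlet_primitive h1 (dvdn_gcdl f1 f2) glt.
case: chia.
have [s aE] : exists s, a = 1 + s * gcdz f1%:Z f2%:Z.
  move/eqP: a1; rewrite eqz_mod_dvd => /dvdzP[s sE]; exists s.
  by rewrite /gcdz /= -sE addrC subrK.
have [u [v uv]] := Bezoutz f1%:Z f2%:Z.
pose b := 1 + v * s * f2%:Z.
have bf1 : (b = a %[mod f1%:Z])%Z.
  rewrite aE -uv /b -(modzMDl (s * u) (1 + v * s * f2%:Z)); congr (_ %% _)%Z; ring.
have bf2 : (b = 1 %[mod f2%:Z])%Z by rewrite /b addrC modzMDl.
have cb : coprimez b (lcmn f1 f2)%:Z.
  have : coprimez b (f1%:Z * f2%:Z).
    by rewrite coprimezMr (coprimez_modP bf1) ca (coprimez_modP bf2) /coprimez gcd1z.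
  rewrite !coprimezE abszM /=; apply: coprime_dvdr.
  by rewrite dvdn_lcm dvdn_mulr ?dvdn_mull.
have [c cE cM] := dirichlet_coprime_repr M0 cb.
have cE1 : (c = a %[mod f1%:Z])%Z.
  rewrite -bf1; apply/eqP; rewrite eqz_mod_dvd;
    apply: dvdz_trans (_ : ((lcmn f1 f2)%:Z %| _)%Z).
    by rewrite dvdzE /= dvdn_lcml.
  by rewrite -eqz_mod_dvd; apply/eqP.
have cE2 : (c = 1 %[mod f2%:Z])%Z.
  rewrite -bf2; apply/eqP; rewrite eqz_mod_dvd;
    apply: dvdz_trans (_ : ((lcmn f1 f2)%:Z %| _)%Z).
    by rewrite dvdzE /= dvdn_lcmr.
  by rewrite -eqz_mod_dvd; apply/eqP.
rewrite -(dirichlet_modz h1 cE1) chi12 //.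
- by rewrite (dirichlet_modz h2 cE2) (dirichlet1 h2).
- by rewrite (coprimez_modP cE1).
- by rewrite (coprimez_modP cE2) /coprimez gcd1z.
Qed.

Lemma primitive_dirichlet_uniq f1 f2 chi1 chi2 M : (0 < M)%N ->
  primitive_dirichlet f1 chi1 -> primitive_dirichlet f2 chi2 ->
  (forall a, coprimez a M%:Z -> coprimez a f1%:Z -> coprimez a f2%:Z ->
     chi1 a = chi2 a) -> f1 = f2 /\ chi1 = chi2.
Proof.
move=> M0 h1 h2 chi12.
have f12 : f1 = f2.
  apply/eqP; rewrite eqn_dvd (primitive_conductor_dvd M0 h1 h2) //=.
  by apply: (primitive_conductor_dvd M0 h2 h1) => a cM c2 c1; rewrite chi12.
split=> //; apply/funext => a; rewrite -f12 in h2 chi12.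
have [ca|nca] := boolP (coprimez a f1%:Z); last first.
  by rewrite (dirichlet_eq0 h1) // (dirichlet_eq0 h2).
have [b ba cb] := dirichlet_coprime_repr M0 ca.
by rewrite -(dirichlet_modz h1 ba) -(dirichlet_modz h2 ba) chi12 // (coprimez_modP ba).
Qed.

Lemma conductorE f chi : primitive_dirichlet f chi -> conductor chi = f.
Proof.
move=> hchi; have hc : primitive_dirichlet (conductor chi) chi.
  exact: (@getPex _ [set f | primitive_dirichlet f chi] (ex_intro _ f hchi)).
by have [] := primitive_dirichlet_uniq (ltn0Sn 0) hc hchi (fun _ _ _ _ => erefl).
Qed.

Lemma dirichlet_sum0 f chi : (1 < f)%N -> primitive_dirichlet f chi ->
  \sum_(i < f) chi (i : nat)%:Z = 0.
Proof.
move=> f1 hchi; have f0 : (0 < f)%N := ltnW f1.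
have [b [cb _ chib]] := dirichlet_primitive hchi (dvd1n f) f1.
apply/eqP; have : (1 - chi b) * (\sum_(i < f) chi (i : nat)%:Z) == 0.
  rewrite mulrBl mul1r subr_eq0 mulr_sumr; apply/eqP.
  rewrite -(sum_modz_mull f0 cb (dirichlet_modz hchi)).
  by apply: eq_bigr => i _; rewrite (dirichletM hchi).
by rewrite mulf_eq0 subr_eq0 => /orP[/eqP/esym|//].
Qed.

End Primitive.

(** * Bernoulli polynomials *)

Lemma mul_bin_swap (n j k : nat) : (j + k <= n)%N ->
  ('C(n, k) * 'C(n - k, j) = 'C(n, j) * 'C(n - j, k))%N.
Proof.
move=> jkn; have kn : (k <= n)%N := leq_trans (leq_addl _ _) jkn.
have jn : (j <= n)%N := leq_trans (leq_addr _ _) jkn.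
apply/eqP; rewrite -(eqn_pmul2r (_ : 0 < k`! * j`! * (n - k - j)`!)%N); last first.
  by rewrite !muln_gt0 !fact_gt0.
have e1 := bin_fact kn; have e2 := bin_fact jn.
have e3 : ('C(n - k, j) * (j`! * (n - k - j)`!) = (n - k)`!)%N.
  by apply: bin_fact; rewrite leq_subRL // addnC.
have e4 : ('C(n - j, k) * (k`! * (n - k - j)`!) = (n - j)`!)%N.
  by rewrite subnAC; apply: bin_fact; rewrite leq_subRL.
apply/eqP; transitivity n`!.
  by rewrite -e1 -e3; ring.
by rewrite -e2 -e4; ring.
Qed.

Lemma bernoulli_sum_difference (F : comNzRingType) (b : nat -> F) (n : nat) (x : F) :
  (forall m, \sum_(k < m.+1) 'C(m.+1, k)%:R * b k = (m == 0%N)%:R) ->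
  (0 < n)%N ->
  \sum_(k < n.+1) 'C(n, k)%:R * b k * (x + 1) ^+ (n - k) -
  \sum_(k < n.+1) 'C(n, k)%:R * b k * x ^+ (n - k) = n%:R * x ^+ n.-1.
Proof.
move=> brec; case: n => // n _ /=.
rewrite -sumrB big_ord_recr /= subnn !expr0 subrr addr0.
transitivity (\sum_(k < n.+1) \sum_(j < n.+1 | (j + k < n.+1)%N)
    'C(n.+1, k)%:R * b k * ('C(n.+1 - k, j)%:R * x ^+ j)).
  apply: eq_bigr => k _; have kn := ltn_ord k.
  rewrite -mulrBr -mulr_sumr; congr (_ * _).
  rewrite [x + 1]addrC exprDn big_ord_recr /= subnn binn mulr1n expr0 mul1r addrK.
  rewrite (big_ord_widen_cond n.+1 xpredT (fun j => 1 ^+ (n.+1 - k - j) * x ^+ j *+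
    'C(n.+1 - k, j))) ?leq_subr //.
  rewrite big_mkcond [RHS]big_mkcond; apply: eq_bigr => j _.
  by rewrite andTb ltn_subRL addnC expr1n mul1r mulr_natl.
rewrite (exchange_big_dep xpredT) //=.
transitivity (\sum_(j < n.+1) 'C(n.+1, j)%:R * x ^+ j * (j == ord_max)%:R).
  apply: eq_bigr => j _; have jn := ltn_ord j.
  have -> : (j == ord_max) = (n - j == 0)%N.
    by rewrite subn_eq0 -val_eqE /= eqn_leq -ltnS jn.
  rewrite -brec mulr_sumr.
  rewrite -subSn // (big_ord_widen n.+1 (fun k => 'C(n.+1, j)%:R * x ^+ j * ('C(n.+1
    - j, k)%:R * b k))) ?leq_subr //.
  apply: eq_big => k; first by rewrite ltn_subRL.
  move=> jk; rewrite [RHS]mulrACA -natrM -mul_bin_swap 1?ltnW // natrM; ring.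
rewrite (bigD1 ord_max) //= eqxx mulr1 big1 ?addr0 ?binSn // => j /negPf ->.
by rewrite mulr0.
Qed.

Section CharZero.
Variable F : fieldType.
Hypothesis char0 : forall n, (0 < n)%N -> n%:R != 0 :> F.

Lemma char0_intr_neq0 (m : int) : m != 0 -> m%:~R != 0 :> F.
Proof. by case: m => n n0; rewrite ?NegzE ?mulrNz ?oppr_eq0 char0 // lt0n. Qed.

Lemma char0_natr_inj : injective (fun n : nat => n%:R : F).
Proof.
move=> m n /eqP mn; apply/eqP; move: mn.
rewrite !pmulrn -subr_eq0 -rmorphB /= -eqz_nat -(subr_eq0 m%:Z).
by apply: contraTT => /char0_intr_neq0.
Qed.

(* The library's morphism structure on [ratr] needs an ordered target field. *)
Lemma ratr_frac (x : rat) (n d : int) : x * d%:~R = n%:~R -> d != 0 ->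
  ratr x = n%:~R / d%:~R :> F.
Proof.
move=> xdn d0; apply/(canRL (mulfK (char0_intr_neq0 d0))).
rewrite /ratr mulrAC; apply: (canLR (mulfK (char0_intr_neq0 (denq_neq0 x)))).
rewrite -!intrM; congr (_%:~R); apply: (@intr_inj rat).
by rewrite !intrM numqE -xdn; ring.
Qed.

Lemma ratr_zmod_morphism : zmod_morphism (ratr : rat -> F).
Proof.
move=> x y; have [dx dy] := (char0_intr_neq0 (denq_neq0 x), char0_intr_neq0
  (denq_neq0 y)).
rewrite (@ratr_frac (x - y) (numq x * denq y - numq y * denq x) (denq x * denq y)).
- rewrite /ratr intrB !intrM. field. by rewrite dx dy.
- by rewrite rmorphB !rmorphM /= !numqE; ring.
- by rewrite mulf_neq0 ?denq_neq0.
Qed.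

Lemma ratr_monoid_morphism : monoid_morphism (ratr : rat -> F).
Proof.
split=> [|x y]; first exact: (ratr_int F 1).
have [dx dy] := (char0_intr_neq0 (denq_neq0 x), char0_intr_neq0 (denq_neq0 y)).
rewrite (@ratr_frac (x * y) (numq x * numq y) (denq x * denq y)).
- rewrite /ratr !intrM. field. by rewrite dx dy.
- by rewrite !rmorphM /= !numqE; ring.
- by rewrite mulf_neq0 ?denq_neq0.
Qed.

Lemma ratr_rmorphism : exists phi : {rmorphism rat -> F}, phi = ratr :> (rat -> F).
Proof.
pose phiA := GRing.isZmodMorphism.Build _ _ _ ratr_zmod_morphism.
pose phiM := GRing.isMonoidMorphism.Build _ _ _ ratr_monoid_morphism.
by exists (HB.pack_for {rmorphism rat -> F} (ratr : rat -> F) phiA phiM).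
Qed.

Lemma bernoulli_poly_difference (n : nat) (x : F) : (0 < n)%N ->
  let P := map_poly (ratr : rat -> F) (bernoulli_poly n) in
  P.[x + 1] - P.[x] = n%:R * x ^+ n.-1.
Proof.
move=> n0; have [phi phiE] := ratr_rmorphism.
have PE y : (map_poly phi (bernoulli_poly n)).[y] =
    \sum_(k < n.+1) 'C(n, k)%:R * phi (bernoulli_number k) * y ^+ (n - k).
  rewrite /bernoulli_poly rmorph_sum horner_sum; apply: eq_bigr => k _ /=.
  by rewrite map_polyZ map_polyXn hornerZ hornerXn rmorphM rmorph_nat.
rewrite /= -phiE !PE; apply: (@bernoulli_sum_difference F (fun k => phi
  (bernoulli_number k))) => // m.
rewrite -[RHS](rmorph_nat phi) -bernoulli_number_rec rmorph_sum.
by apply: eq_bigr => k _; rewrite rmorphM rmorph_nat.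
Qed.

Lemma periodic_poly_const (P : {poly F}) :
  (forall x, P.[x + 1] = P.[x]) -> forall x, P.[x] = P.[0].
Proof.
move=> per; pose Q := P - P.[0]%:P.
suff Q0 : Q = 0 by move=> x; apply/eqP;
  rewrite -subr_eq0 -(hornerC P.[0] x) -hornerN -hornerD -/Q Q0 horner0.
have Pn (n : nat) : P.[n%:R] = P.[0].
  by elim: n => // n IH; rewrite -addn1 natrD per.
apply/eqP/negPn/negP => Qn0.
have := @max_poly_roots _ Q [seq (i%:R : F) | i <- iota 0 (size Q)] Qn0.
rewrite size_map size_iota ltnn => /(_ _ _)/negP []; last by [].
  by apply/allP => _ /mapP[i _ ->]; rewrite rootE !hornerE Pn subrr.
by rewrite map_inj_uniq ?iota_uniq //; apply: char0_natr_inj.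
Qed.

Section Difference.
Variables (n : nat) (P : {poly F}).
Hypothesis n_gt0 : (0 < n)%N.
Hypothesis dP : forall x, P.[x + 1] - P.[x] = n%:R * x ^+ n.-1.

Lemma sum_powers (m : nat) :
  \sum_(0 <= l < m) (l%:R : F) ^+ n.-1 = (P.[m%:R] - P.[0]) / n%:R.
Proof.
apply: (canRL (mulfK (char0 n_gt0))); elim: m => [|m IH].
  by rewrite big_nil mul0r subrr.
rewrite big_nat_recr //= mulrDl IH [_ * n%:R]mulrC -dP -natr1.
by rewrite addrC addrA subrK.
Qed.

(* For Bernoulli polynomials [c] is 0; an unspecified constant is enough here,
   since it is multiplied by a vanishing character sum. *)
Lemma distribution_relation (M : nat) : (0 < M)%N ->
  exists c, forall x,
    M%:R ^+ n.-1 * \sum_(i < M) P.[(x + i%:R) / M%:R] = P.[x] + c.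
Proof.
case: M => // M _; set m : F := M.+1%:R; have m0 : m != 0 by apply: char0.
pose G := m ^+ n.-1 *: (\sum_(i < M.+1) (P \Po (m^-1 *: ('X + i%:R%:P)))) - P.
have GE x : G.[x] = m ^+ n.-1 * (\sum_(i < M.+1) P.[(x + i%:R) / m]) - P.[x].
  rewrite !hornerE horner_sum; congr (_ * _ - _); apply: eq_bigr => i _.
  by rewrite horner_comp !hornerE mulrC.
exists G.[0] => x; rewrite -(@periodic_poly_const G _ x);
  first by rewrite GE addrC subrK.
move=> {}x; apply/eqP; rewrite -subr_eq0 !GE; apply/eqP.
have step : \sum_(i < M.+1) P.[(x + 1 + i%:R) / m] =
            \sum_(i < M.+1) P.[(x + i%:R) / m] + n%:R * (x / m) ^+ n.-1.
  rewrite big_ord_recr big_ord_recl /= addr0 -dP.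
  have -> : (x + 1 + M%:R) / m = x / m + 1.
    by rewrite -addrA [1 + _]addrC natr1 mulrDl divff.
  under [X in _ = _ + X + _]eq_bigr => i _ do rewrite /bump /= natrD addrA.
  ring.
rewrite step mulrDr expr_div_n mulrCA [m ^+ _ * (_ / _)]mulrCA mulfV ?expf_neq0 //
  mulr1.
have := dP x; move/(canRL (subrK _)) ->; ring.
Qed.
End Difference.
End CharZero.

Lemma sum_nat_blocks (V : nmodType) (a k m : nat) (F : nat -> V) :
  \sum_(a <= i < a + m * k) F i = \sum_(a <= j < a + k) \sum_(i < m) F (j + i * k)%N.
Proof.
elim: m => [|m IH].
  by rewrite mul0n addn0 big_geq // big1 // => j _; rewrite big_ord0.
rewrite mulSn addnA addnAC (@big_cat_nat _ _ _ (a + m * k)%N) ?leq_addr //= IH.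
under [RHS]eq_bigr => j _ do rewrite big_ord_recr /=.
rewrite [RHS]big_split /=; congr (_ + _).
by rewrite addnAC big_addn addnK.
Qed.

Lemma gen_bernoulli_sum (F : fieldType) (f : nat) (chi : int -> F) (n N : nat) :
  (forall m, (0 < m)%N -> m%:R != 0 :> F) -> (1 < f)%N -> primitive_dirichlet f chi ->
  (0 < n)%N -> (0 < N)%N -> (f %| N)%N ->
  N%:R ^+ n.-1 * \sum_(k < N)
    chi (k : nat)%:Z * (map_poly (ratr : rat -> F) (bernoulli_poly n)).[k%:R / N%:R]
  = gen_bernoulli n chi.
Proof.
move=> char0 f1 hchi n0 N0 /dvdnP[M NE].
have f0 : (0 < f)%N := ltnW f1; have fn0 : f%:R != 0 :> F := char0 _ f0.
have M0 : (0 < M)%N by move: N0; rewrite NE muln_gt0 => /andP[].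
have Mn0 : M%:R != 0 :> F := char0 _ M0.
set P := map_poly _ _.
have [c dist] := distribution_relation char0 (fun x => bernoulli_poly_difference
  char0 x n0) M0.
have chi0 : chi 0 = 0.
  apply: (dirichlet_eq0 hchi); rewrite /coprimez gcd0z /=.
  by rewrite eqz_nat gtn_eqF.
have chif : chi f%:Z = 0.
  by rewrite -chi0; apply: (dirichlet_modz hchi); rewrite modzz mod0z.
rewrite /gen_bernoulli (conductorE hchi) -/P big_nat_recr //= chif mul0r addr0.
have -> : f%:R ^ (n%:Z - 1) = f%:R ^+ n.-1 :> F.
  by case: (n) n0 => // m _; rewrite intS addrC addKr.
have -> : \sum_(1 <= a < f) chi a%:Z * P.[a%:R / f%:R] = \sum_(a < f) chi (a :
  nat)%:Z * P.[a%:R / f%:R].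
  by rewrite -(big_mkord xpredT (fun a => chi a%:Z * P.[a%:R / f%:R])) [RHS]big_ltn
    // chi0 mul0r add0r.
rewrite -(big_mkord xpredT (fun k => chi k%:Z * P.[k%:R / N%:R])) NE.
rewrite -{2}(add0n (M * f)%N) sum_nat_blocks add0n big_mkord.
transitivity (f%:R ^+ n.-1 * \sum_(a < f) chi (a : nat)%:Z *
    (M%:R ^+ n.-1 * \sum_(i < M) P.[(a%:R / f%:R + i%:R) / M%:R])).
  rewrite natrM exprMn -mulrA mulrCA; congr (_ * _).
  rewrite mulr_sumr; apply: eq_bigr => a _.
  rewrite [RHS]mulrCA [in RHS]mulr_sumr; congr (_ * _); apply: eq_bigr => i _.
  have -> : chi (a + i * f)%N%:Z = chi (a : nat)%:Z.
    by apply: (dirichlet_modz hchi); rewrite PoszD PoszM addrC modzMDl.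
  by congr (_ * P.[_]); rewrite natrD natrM; field; rewrite Mn0 fn0.
under eq_bigr => a _ do rewrite dist mulrDr.
by rewrite big_split /= -mulr_suml (dirichlet_sum0 f1 hchi) mul0r addr0.
Qed.

(** * Convergence of the polygamma limit *)

Lemma sum_multiples (V : nmodType) (p i y : nat) (F : nat -> V) : (i < p)%N ->
  \sum_(0 <= l < p * y - i | (p %| l)%N) F l = \sum_(l < y) F (p * l)%N.
Proof.
move=> ip; have p0 : (0 < p)%N := leq_ltn_trans (leq0n _) ip.
case: y => [|y]; first by rewrite muln0 sub0n big_nil big_ord0.
transitivity (\sum_(0 <= l < p * y.+1 | (p %| l)%N) F l).
  rewrite [RHS](@big_cat_nat _ _ _ (p * y.+1 - i)%N) ?leq_subr //=.
  rewrite [X in _ = _ + X]big_nat_cond [X in _ = _ + X]big1 ?addr0 // => l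
    /andP[/andP[l1 l2] /dvdnP[c lE]].
  move: l1 l2; rewrite lE [(c * p)%N]mulnC ltn_pmul2l // ltnS leq_subLR => l1 cy.
  have : (p * y.+1 <= i + p * y)%N by rewrite (leq_trans l1) // leq_add2l leq_mul2l
    cy orbT.
  by rewrite mulnS leq_add2r leqNgt ip.
rewrite big_mkcond mulnC -[X in \sum_(0 <= _ < X) _]add0n sum_nat_blocks add0n.
rewrite big_ltn // [X in _ + X]big_nat [X in _ + X]big1 ?addr0 => [|j /andP[j0 jp]].
  by apply: eq_bigr => l _; rewrite add0n dvdn_mull // mulnC.
apply: big1 => l _; rewrite dvdn_addl ?dvdn_mull //.
by rewrite /dvdn modn_small // -leqn0 leqNgt j0.
Qed.

Section PadicSums.
Variables (R : realType) (p : nat) (K : padicClosureType R p).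
Hypothesis hp : prime p.

Definition unit_expz (s : int) (k : nat) : K :=
  if (p %| k)%N then 0 else k%:R ^ s.

Lemma unit_expz_le1 s k : pabs (unit_expz s k) <= 1.
Proof.
rewrite /unit_expz; case: ifPn => pk; first by rewrite pabs0 ler01.
by rewrite pabs_unit_expz // pabs_nat_coprime.
Qed.

Lemma unit_expzB s k i M :
  pabs (unit_expz s (k + i * p ^ M.+1) - unit_expz s k) <= p%:R^-1 ^+ M.+1.
Proof.
rewrite /unit_expz dvdn_addl ?dvdn_mull ?dvdn_exp //.
case: ifPn => pk; first by rewrite subrr pabs0 pinvX_ge0.
apply: le_trans (pabs_exprzB _ _ _) _.
- by rewrite pabs_nat_coprime // dvdn_addl ?dvdn_mull ?dvdn_exp.
- by rewrite pabs_nat_coprime.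
rewrite natrD addrC addKr natrM pabsM natrX pabs_expp.
by rewrite ler_piMl ?pinvX_ge0 // pabs_nat_le1.
Qed.

Lemma unit_expz_block s x M :
  pabs (\sum_(x <= k < x + p ^ M.+1) unit_expz s k) <= p%:R^-1 ^+ M.
Proof.
elim: M => [|M IH].
  by apply: pabs_sum_le => // k _; apply: unit_expz_le1.
rewrite [(p ^ M.+2)%N]expnS sum_nat_blocks.
have -> : \sum_(x <= j < x + p ^ M.+1) \sum_(i < p) unit_expz s (j + i * p ^ M.+1)
  = p%:R * \sum_(x <= j < x + p ^ M.+1) unit_expz s j +
    \sum_(x <= j < x + p ^ M.+1) \sum_(i < p)
      (unit_expz s (j + i * p ^ M.+1) - unit_expz s j).
  rewrite mulr_sumr -big_split /=; apply: eq_bigr => j _.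
  by rewrite sumrB sumr_const card_ord mulr_natl addrC subrK.
apply: pabsD_le; first by rewrite pabsM pabs_p exprS ler_pM2l ?pinv_gt0.
apply: pabs_sum_le => [|j _]; first exact: pinvX_ge0.
apply: pabs_sum_le => [|i _]; first exact: pinvX_ge0.
exact: unit_expzB.
Qed.

Definition unit_power_sum (s : int) (n : nat) : K := \sum_(0 <= k < n) unit_expz s k.

Lemma unit_power_sumB s x y M : (x = y %[mod p ^ M.+1])%N ->
  pabs (unit_power_sum s x - unit_power_sum s y) <= p%:R^-1 ^+ M.
Proof.
wlog yx : x y / (y <= x)%N.
  move=> H xy; case/orP: (leq_total x y) => le; last exact: H.
  by rewrite pabsC; apply: H.
move/eqP; rewrite eqn_mod_dvd // => /dvdnP[t tE].
have {tE yx} -> : x = (y + t * p ^ M.+1)%N by rewrite -tE subnKC.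
elim: t => [|t IH]; first by rewrite mul0n addn0 subrr pabs0 pinvX_ge0.
apply: pabs_trans IH; rewrite /unit_power_sum mulSn addnA addnAC.
rewrite (@big_cat_nat _ _ _ (y + t * p ^ M.+1)) ?leq_addr //= [X in pabs X]addrC addKr.
exact: unit_expz_block.
Qed.

Lemma padic_polygamma_sumE (r : int) n :
  \sum_(1 <= k < n | ~~ (p %| k)%N) (k%:R : K) ^ (- (r + 1)) = unit_power_sum (- (r +
    1)) n.
Proof.
rewrite /unit_power_sum; case: n => [|n]; first by rewrite !big_geq.
rewrite [RHS]big_ltn // {1}/unit_expz dvdn0 add0r big_mkcond /=.
by apply: eq_bigr => k _; rewrite /unit_expz; case: (p %| k)%N.
Qed.

Lemma unit_power_sum_rat s n : rat_closure (pabs : K -> R) (unit_power_sum s n).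
Proof.
have [phi phiE] := ratr_rmorphism (padic_nat_neq0 K hp).
move=> e e0; exists (\sum_(0 <= k < n) if (p %| k)%N then 0 else k%:R ^ s).
rewrite -phiE rmorph_sum /= /unit_power_sum -sumrB big1 ?pabs0 // => k _.
rewrite /unit_expz; case: ifP => _; first by rewrite rmorph0 subrr.
by rewrite fmorphXz rmorph_nat subrr.
Qed.

Lemma pabs_le_modn x y M :
  pabs (x%:R - y%:R : K) <= p%:R^-1 ^+ M -> (x = y %[mod p ^ M])%N.
Proof.
case: M => [|M] xy; first by rewrite expn0 !modn1.
have : (p%:Z ^+ M.+1 %| x%:Z - y%:Z)%Z.
  apply: (pabs_lt_dvdz (K := K) hp); rewrite rmorphB /=.
  by apply: le_lt_trans xy _; rewrite exprS gtr_pMl ?exprn_gt0 ?pinv_gt0 ?pinv_lt1.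
by rewrite -eqz_mod_dvd -[p%:Z]natz -natrX natz !modz_nat => /eqP [].
Qed.

Lemma padic_polygamma_lim (r : int) (z : K) :
  (forall M, exists2 x, (0 < x)%N & pabs (x%:R - z) <= p%:R^-1 ^+ M) ->
  forall M x, (0 < x)%N -> pabs (x%:R - z) <= p%:R^-1 ^+ M.+1 ->
    pabs (unit_power_sum (- (r + 1)) x - padic_polygamma r z) <= p%:R^-1 ^+ M.
Proof.
move=> dense; set S := unit_power_sum _.
have close x y M : pabs (x%:R - z) <= p%:R^-1 ^+ M.+1 -> pabs (y%:R - z) <= p%:R^-1
  ^+ M.+1 ->
    pabs (S x - S y) <= p%:R^-1 ^+ M.
  move=> xz yz; apply: unit_power_sumB; apply: pabs_le_modn.
  by apply: pabs_trans xz _; rewrite pabsC.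
pose a M := s2val (cid2 (dense M.+1)).
have aP M : pabs ((a M)%:R - z) <= p%:R^-1 ^+ M.+1 by exact: s2valP' (cid2 (dense
  M.+1)).
have cauchy M m : (M <= m)%N -> pabs (S (a m) - S (a M)) <= p%:R^-1 ^+ M.
  move=> Mm; apply: close; last exact: (aP M).
  by apply: le_trans (aP m) _; apply: pinvX_le.
have [G GP] : exists G : K, forall e, 0 < e -> exists M : nat, forall n : nat,
       (M <= n)%N -> pabs (S (a n) - G) < e.
  apply: rat_closure_complete => [n|e e0]; first exact: unit_power_sum_rat.
  have [M Me] := pinvX_lt hp e0; exists M => m n Mm Mn.
  apply: le_lt_trans Me; apply: (pabs_trans (y := S (a M))); first exact: cauchy.
  by rewrite pabsC; apply: cauchy.
have SG x M : pabs (x%:R - z) <= p%:R^-1 ^+ M.+1 -> pabs (S x - G) <= p%:R^-1 ^+ M.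
  move=> xz; have [m mP] := GP (p%:R^-1 ^+ M) (exprn_gt0 _ (pinv_gt0 R hp)).
  apply: (pabs_trans (y := S (a (maxn m M)))); last by apply/ltW/mP/leq_maxl.
  apply: close => //; apply: le_trans (aP _) _; apply: pinvX_le => //.
  by rewrite ltnS leq_maxr.
suff -> : padic_polygamma r z = G by move=> M x _; apply: SG.
have FF : ProperFilter (posint_nbhs z).
  apply: Build_ProperFilter_ex => [A|].
    move=> /nbhs_padicP[e e0 zA].
    have [M Me] := pinvX_lt hp e0; have [x x0 xz] := dense M.
    by exists x; apply: (zA x%:R) => //; rewrite pabsC (le_lt_trans xz).
  split=> [|A B /nbhs_padicP[e e0 zA] /nbhs_padicP[d d0 zB]|A B AB /nbhs_padicP[e e0
    zA]].
  - by apply/nbhs_padicP; exists 1.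
  - apply/nbhs_padicP; exists (Num.min e d) => [|y]; first by rewrite lt_min e0.
    by rewrite lt_min => /andP[ye yd] n n0 ny; split; [apply: zA ny|apply: zB ny].
  - by apply/nbhs_padicP; exists e => // y ye n n0 ny; apply/AB/(zA y).
rewrite /padic_polygamma; apply: cvg_lim; first exact: metric_hausdorff.
move=> A /nbhs_padicP[e e0 GA]; apply/nbhs_padicP.
have [M Me] := pinvX_lt hp e0.
exists (p%:R^-1 ^+ M.+1) => [|y zy n n0 ny]; first by rewrite exprn_gt0 ?pinv_gt0.
rewrite /= padic_polygamma_sumE; apply: GA; rewrite pabsC.
by apply: le_lt_trans Me; apply: SG; rewrite ny pabsC ltW.
Qed.

End PadicSums.

Section Approximation.
Variables (R : realType) (p : nat) (K : padicClosureType R p).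
Hypothesis hp : prime p.

Lemma pabs_eqn_mod x y M : (x = y %[mod p ^ M])%N ->
  pabs (x%:R - y%:R : K) <= p%:R^-1 ^+ M.
Proof.
move=> xy; have : (p%:Z ^+ M %| x%:Z - y%:Z)%Z.
  by rewrite -eqz_mod_dvd -[p%:Z]natz -natrX natz !modz_nat xy.
by move/(pabs_dvdz K); rewrite rmorphB.
Qed.

Lemma pabs_subr_div (N k x M : nat) : ~~ (p %| N)%N ->
  (N * x = k %[mod p ^ M])%N -> pabs (x%:R - k%:R / N%:R : K) <= p%:R^-1 ^+ M.
Proof.
move=> pN Nx; have N1 := pabs_nat_coprime K hp pN.
have N0 := pabs_eq1_neq0 N1.
have -> : x%:R - k%:R / N%:R = ((N * x)%:R - k%:R) / N%:R :> K by rewrite natrM; field.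
by rewrite pabsM pabsV N1 invr1 mulr1 pabs_eqn_mod.
Qed.

Lemma natmul_mod_expp (N k M : nat) : ~~ (p %| N)%N ->
  exists2 x, (0 < x)%N & (N * x = k %[mod p ^ M])%N.
Proof.
move=> pN; have cN : coprime N (p ^ M) by rewrite coprime_sym coprimeXl //
  prime_coprime.
have pM0 : (0 < p ^ M)%N by rewrite expn_gt0 prime_gt0.
exists (k * N ^ (totient (p ^ M)).-1 + p ^ M)%N; first by rewrite addn_gt0 pM0 orbT.
rewrite mulnDr addnC modnMDl mulnCA -expnS prednK ?totient_gt0 //.
by rewrite -modnMmr (Euler_exp_totient cN) modnMmr muln1.
Qed.

Lemma pabs_expz_totient (l n t j : nat) (s : int) : ~~ (p %| l)%N ->
  n%:Z = s + (totient (p ^ j.+1) * t)%N%:Z ->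
  pabs ((l%:R : K) ^ s - l%:R ^+ n) <= p%:R^-1 ^+ j.
Proof.
move=> pl nE; have l1 := pabs_nat_coprime K hp pl.
have l0 := pabs_eq1_neq0 l1.
have -> : l%:R ^+ n = l%:R ^ s * (l ^ (totient (p ^ j.+1) * t))%N%:R :> K.
  by rewrite natrX -[LHS]/(l%:R ^ n%:Z) nE expfzDr.
rewrite -[X in X - _]mulr1 -mulrBr pabsM pabs_unit_expz // mul1r pabsC.
apply: le_trans (pinvX_le R hp (leqnSn j)); apply: (pabs_eqn_mod (y := 1)).
have cl : coprime l (p ^ j.+1) by rewrite coprime_sym coprimeXl // prime_coprime.
by rewrite expnM -modnXm (Euler_exp_totient cl) modnXm exp1n.
Qed.

(* Writing p u = i N + k, if N y = u modulo a high power of p, then x = p y - i is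
   close to k / N and the multiples of p below x are the p l with l < y. *)
Lemma polygamma_approx (r : int) (N u n j : nat) (P : {poly K})
    (k := (p * u %% N)%N) (Q := fun z => (P.[z] - P.[0]) / n%:R) :
  ~~ (p %| N)%N -> (u < N)%N -> (0 < n)%N ->
  (forall x, P.[x + 1] - P.[x] = n%:R * x ^+ n.-1) ->
  (forall l, ~~ (p %| l)%N ->
     pabs ((l%:R : K) ^ (- r) - l%:R ^+ n.-1) <= p%:R^-1 ^+ j) ->
  pabs (padic_polygamma (r - 1) (k%:R / N%:R) -
        (Q (k%:R / N%:R) - p%:R ^+ n.-1 * Q (u%:R / N%:R))) <= p%:R^-1 ^+ j.
Proof.
move=> pN uN n0 dP close.
have char0 := padic_nat_neq0 K hp.
have p0 := prime_gt0 hp.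
have N0 : (0 < N)%N := leq_ltn_trans (leq0n u) uN.
have N1 := pabs_nat_coprime K hp pN.
pose i := (p * u %/ N)%N.
have ip : (i < p)%N by rewrite ltn_divLR // ltn_pmul2l.
have [C C0 CP] := pabs_hornerB P.
have C1 : 0 < C + 1 by rewrite ltr_wpDl.
have nn : 0 < pabs (n%:R : K) by rewrite pabs_gt0 ?char0.
have [m mP] := pinvX_lt hp (divr_gt0 (mulr_gt0 (exprn_gt0 j (pinv_gt0 R hp)) nn) C1).
pose M := maxn m j.
have div1 a : pabs (a%:R / N%:R : K) <= 1 by rewrite pabsM pabsV N1 invr1 mulr1
  pabs_nat_le1.
have QB (x z : K) : pabs x <= 1 -> pabs z <= 1 -> pabs (x - z) <= p%:R^-1 ^+ M.+1 ->
    pabs (Q x - Q z) <= p%:R^-1 ^+ j.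
  move=> x1 z1 xz; rewrite /Q -mulrBl opprB addrA subrK pabsM pabsV ler_pdivrMr //.
  apply: le_trans (CP _ _ x1 z1) _; move: mP; rewrite ltr_pdivlMr // => /ltW;
    apply: le_trans.
  rewrite mulrC ler_pM ?pabs_ge0 ?lerDl //; apply: le_trans xz _.
  by rewrite pinvX_le // (leq_trans (leq_maxl m j)).
have [y y0 yu] := natmul_mod_expp u M.+1 pN.
have ipy : (i < p * y)%N by rewrite (leq_trans ip) // leq_pmulr.
pose x := (p * y - i)%N.
have x0 : (0 < x)%N by rewrite subn_gt0.
have xk : (N * x = k %[mod p ^ M.+1])%N.
  apply/eqP; rewrite -(eqn_modDl (N * i)) -mulnDr subnKC 1?ltnW //.
  rewrite mulnCA -modnMmr yu modnMmr [(N * i)%N]mulnC -divn_eq eqxx //.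
have xz := pabs_subr_div pN xk; have yz := pabs_subr_div pN yu.
have dense L : exists2 x, (0 < x)%N & pabs (x%:R - k%:R / N%:R : K) <= p%:R^-1 ^+ L.
  by have [a a0 ak] := natmul_mod_expp k L pN; exists a => //; apply: pabs_subr_div.
have G := padic_polygamma_lim hp (r - 1) dense x0 xz.
rewrite pabsC; pose T : K := \sum_(0 <= l < x) if (p %| l)%N then 0 else l%:R ^+ n.-1.
have ST : pabs (T - unit_power_sum K (- (r - 1 + 1)) x) <= p%:R^-1 ^+ j.
  rewrite /T /unit_power_sum -sumrB; apply: pabs_sum_le => [|l _];
    first exact: pinvX_ge0.
  rewrite /unit_expz subrK; case: ifPn => pl; first by rewrite subrr pabs0 pinvX_ge0.
  by rewrite pabsC close.
have TE : T = Q x%:R - p%:R ^+ n.-1 * Q y%:R.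
  have -> : p%:R ^+ n.-1 * Q y%:R = \sum_(0 <= l < x | (p %| l)%N) (l%:R : K) ^+ n.-1.
    rewrite sum_multiples // /Q -(sum_powers char0 n0 dP) mulr_sumr big_mkord.
    by apply: eq_bigr => l _; rewrite natrM exprMn.
  rewrite /Q -(sum_powers char0 n0 dP); apply: (canRL (addrK _)).
  rewrite [X in _ + X]big_mkcond -big_split /=.
  by apply: eq_bigr => l _; case: ifP; rewrite ?add0r ?addr0.
apply: (pabs_trans (y := T)).
  have -> : Q (k%:R / N%:R) - p%:R ^+ n.-1 * Q (u%:R / N%:R) - T =
      (Q (k%:R / N%:R) - Q x%:R) - p%:R ^+ n.-1 * (Q (u%:R / N%:R) - Q y%:R).
    by rewrite TE; ring.
  apply: pabsB_le; first by rewrite pabsC QB ?pabs_nat_le1.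
  rewrite pabsM -[leRHS]mul1r ler_pM ?pabs_ge0 //;
    last by rewrite pabsC QB ?pabs_nat_le1.
  by rewrite -natrX pabs_nat_le1.
apply: (pabs_trans ST); apply: le_trans G _; apply: pinvX_le => //.
exact: leq_maxr.
Qed.
End Approximation.

(** * Teichmuller representatives and twists *)

Section Teichmuller.
Variables (R : realType) (p : nat) (K : padicClosureType R p).
Hypothesis hp : prime p.

Local Notation q := (teich_modulus p).

Lemma coprimez_teich_modulus (a : int) : coprimez a q%:Z = ~~ (p %| a)%Z.
Proof.
rewrite coprimezE /= dvdzE /= coprime_sym /teich_modulus; case: eqP => [->|_].
  by rewrite -[4%N]/(2 ^ 2)%N coprime_pexpl // prime_coprime.
by rewrite prime_coprime.
Qed.

Lemma teich_modulus_proper_dvd (d : nat) (a : int) :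
  (d %| q)%N -> (d < q)%N -> ~~ (p %| a)%Z -> (d%:Z %| a - 1)%Z.
Proof.
rewrite /teich_modulus; case: eqP => [-> |_ dp dltp _]; last first.
  move: dp; rewrite dvdn_divisors ?prime_gt0 // => dp.
  have : d == 1%N.
    by move: dp; rewrite -dvdn_divisors ?prime_gt0 // => /(primeP hp).2/orP[//|/eqP
      dE]; rewrite dE ltnn in dltp.
  by move/eqP ->; rewrite dvd1z.
move=> d4 dlt a2; apply: (@dvdz_trans 2%:Z).
  by rewrite dvdzE; move: d dlt d4 => [|[|[|[|d]]]].
have := modz_ge0 a (d := 2%:Z) isT; have := ltz_pmod a (d := 2%:Z) isT.
move: a2; rewrite -eqz_mod_dvd => /dvdz_mod0P.
by case: (a %% 2)%Z => [[|[|n]]|n].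
Qed.

Lemma pabs_exprB_eq (x y : K) m : pabs x = 1 -> pabs y = 1 ->
  pabs (m%:R : K) = 1 -> pabs (x - y) < 1 ->
  pabs (x ^+ m - y ^+ m) = pabs (x - y).
Proof.
move=> x1 y1 m1 xy; rewrite subrXX pabsM -[RHS]mulr1; congr (_ * _).
case: m m1 => [|m] m1; first by move: m1; rewrite pabs0 => /eqP;
  rewrite eq_sym oner_eq0.
set s := \sum_(i < _) _.
have small : pabs (s - m.+1%:R * x ^+ m) < 1.
  apply: le_lt_trans xy; rewrite mulr_natl -[X in _ *+ X]card_ord -sumr_const -sumrB.
  apply: pabs_sum_le => [|i _]; first exact: pabs_ge0.
  have -> : x ^+ (m.+1.-1 - i) * y ^+ i - x ^+ m = x ^+ (m - i) * (y ^+ i - x ^+ i).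
    by rewrite mulrBr -exprD subnK // -ltnS.
  by rewrite pabsM pabsX x1 expr1n mul1r [leRHS]pabsC pabs_exprB ?x1 ?y1.
have u1 : pabs (m.+1%:R * x ^+ m) = 1 by rewrite pabsM pabsX x1 expr1n m1 mulr1.
have s1 : pabs s <= 1.
  apply: pabs_sum_le => // i _; rewrite pabsM !pabsX x1 y1 !expr1n mulr1 //.
apply/eqP; rewrite eq_le s1 leNgt; apply/negP => lt_s.
by have := pabsD_lt lt_s (_ : pabs (m.+1%:R * x ^+ m - s) < 1);
  rewrite subrKC u1 ltxx pabsC => /(_ small).
Qed.

Lemma pabs_root1 (x : K) m : (0 < m)%N -> x ^+ m = 1 -> pabs x = 1.
Proof. by move=> m0 xm; apply: (pabs_expr_eq1 m0); rewrite -pabsX xm pabs1. Qed.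

Lemma teich_modulus_odd : p != 2%N -> q = p /\ totient q = p.-1.
Proof. by rewrite /teich_modulus => /negPf ->; rewrite totient_prime. Qed.

Lemma teichmuller_uniq (x y : K) :
  x ^+ totient q = 1 -> y ^+ totient q = 1 -> pabs (x - y) <= pabs (q%:R : K) -> x = y.
Proof.
move=> xm ym xy; apply/eqP; rewrite -subr_eq0; apply/eqP/pabs_eq0.
have [p2|p2] := eqVneq p 2%N; last first.
  move: xm ym xy; have [-> ->] := teich_modulus_odd p2 => xm ym xy.
  have p1 : (0 < p.-1)%N by rewrite -ltnS prednK ?prime_gt0 // prime_gt1.
  rewrite -(pabs_exprB_eq (m := p.-1) (pabs_root1 p1 xm) (pabs_root1 p1 ym)).
  - by rewrite xm ym subrr pabs0.
  - by rewrite pabs_nat_coprime // gtnNdvd // prednK // prime_gt0.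
  - by rewrite (le_lt_trans xy) // pabs_p pinv_lt1.
have q4 : q = 4%N by rewrite /teich_modulus p2.
move: xm ym xy; rewrite q4 => /eqP xm /eqP ym xy.
have pm (z : K) : z ^+ totient 4 == 1 -> z = 1 \/ z = - 1.
  by rewrite -[totient 4]/2%N sqrf_eq1 => /orP[] /eqP; [left|right].
have lt42 : pabs (4%:R : K) < pabs (2%:R : K).
  have P2 : pabs (2%:R : K) < 1 by rewrite -p2 pabs_p pinv_lt1.
  have -> : 4%:R = 2%:R * 2%:R :> K by rewrite -natrM.
  by rewrite pabsM gtr_pMl // pabs_gt0 // -p2 (padic_nat_neq0 K hp) ?prime_gt0.
have [xE|xE] := pm _ xm; have [yE|yE] := pm _ ym; move: xy;
  rewrite xE yE ?subrr ?pabs0 //.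
  by rewrite opprK -[1 + 1]/(2%:R) leNgt lt42.
by rewrite -opprD pabsN -[1 + 1]/(2%:R) leNgt lt42.
Qed.

Lemma teichmuller_ex (a : int) : ~~ (p %| a)%Z -> exists x : K,
  x ^+ totient q = 1 /\ pabs (x - a%:~R) <= pabs (q%:R : K).
Proof.
move=> pa; have a1 := pabs_coprime K hp pa.
have q0 : (0 < q)%N by rewrite /teich_modulus; case: ifP => // _; apply: prime_gt0.
pose b := absz (a %% q%:Z)%Z.
have bE : b%:Z = (a %% q%:Z)%Z by rewrite gez0_abs // modz_ge0 // eqz_nat -lt0n.
have ab : pabs (b%:R - a%:~R : K) <= pabs (q%:R : K).
  have /dvdzP[c cE] : (q%:Z %| b%:Z - a)%Z by rewrite -eqz_mod_dvd bE modz_mod.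
  rewrite pmulrn -rmorphB /= cE rmorphM pabsM /= -pmulrn.
  by rewrite ler_piMl ?pabs_ge0 // pabs_int_le1.
have cb : coprime b q.
  by rewrite -[coprime _ _]/(coprimez b%:Z q%:Z) (coprimez_modP (b := a))
    ?coprimez_teich_modulus // bE modz_mod.
have [p2|p2] := eqVneq p 2%N.
  have q4 : q = 4%N by rewrite /teich_modulus p2.
  have b4 : (b < 4)%N by rewrite -[4%N]q4 -ltz_nat bE ltz_pmod.
  move: cb ab; rewrite q4 => cb ab.
  have [b1|b3] : b = 1%N \/ b = 3%N by move: b b4 cb {bE ab} => [|[|[|[|b]]]] //; auto.
    by exists 1; rewrite expr1n; split=> //; rewrite b1 in ab.
  exists (- 1); split; first by rewrite -[totient 4]/2%N sqrrN expr1n.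
  apply: pabs_trans ab; rewrite b3.
  by rewrite -opprD pabsN -[1 + _]/(1%:R + _) -natrD.
have [-> ->] := teich_modulus_odd p2; set m := p.-1.
have m0 : (0 < m)%N by rewrite -ltnS prednK ?prime_gt0 // prime_gt1.
have fermat : pabs (a%:~R ^+ m - 1 : K) <= p%:R^-1.
  have qp : q = p by have [] := teich_modulus_odd p2.
  move: ab cb; rewrite qp pabs_p => ab cb.
  apply: (pabs_trans (y := b%:R ^+ m)).
    by apply: le_trans ab; rewrite [leRHS]pabsC pabs_exprB ?a1 // pabs_nat_le1.
  rewrite -natrX -[leRHS]expr1; apply: (pabs_eqn_mod K (y := 1)).
  by rewrite expn1 /m -totient_prime // Euler_exp_totient.
have [rs] := closed_field_poly_normal ('X^m - 1 : {poly K}).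
rewrite lead_coefXnsubC // scale1r => rsE.
have [z zrs za] : exists2 z, z \in rs & pabs (a%:~R - z) < 1.
  apply/hasP; apply: contraLR (le_lt_trans fermat (pinv_lt1 R hp)) => /hasPn far.
  rewrite -leNgt; have -> : a%:~R ^+ m - 1 = \prod_(z <- rs) (a%:~R - z) :> K.
    have := congr1 (horner^~ a%:~R) rsE; rewrite horner_prod !hornerE => ->.
    by apply: eq_bigr => z _; rewrite !hornerE.
  rewrite big_seq; elim/big_ind: _ => [|x y x1 y1|z /far].
  - by rewrite pabs1.
  - by rewrite pabsM mulr_ege1.
  - by rewrite -leNgt.
have zm : z ^+ m = 1.
  apply/eqP; rewrite -subr_eq0; have : root ('X^m - 1) z by rewrite rsE root_prod_XsubC.
  by rewrite rootE !hornerE.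
exists z; split=> //; rewrite pabsC pabs_p -(pabs_exprB_eq (m := m)) ?zm //.
- exact: pabs_root1 zm.
- by rewrite pabs_nat_coprime // gtnNdvd // prednK // prime_gt0.
Qed.

End Teichmuller.

Section Twist.
Variables (R : realType) (p : nat) (K : padicClosureType R p).
Hypothesis hp : prime p.

Local Notation q := (teich_modulus p).
Local Notation w := (teichmuller K).

Lemma teich_modulus_gt0 : (0 < q)%N.
Proof. by rewrite /teich_modulus; case: ifP => // _; apply: prime_gt0. Qed.

Lemma teichmullerP (a : int) : ~~ (p %| a)%Z ->
  w a ^+ totient q = 1 /\ pabs (w a - a%:~R) <= pabs (q%:R : K).
Proof.
move=> pa; rewrite /teichmuller (negPf pa); set A := [set x | _].
by have /getPex : exists x, A x by apply: teichmuller_ex.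
Qed.

Lemma teichmuller_eq (a : int) (x : K) : ~~ (p %| a)%Z ->
  x ^+ totient q = 1 -> pabs (x - a%:~R) <= pabs (q%:R : K) -> w a = x.
Proof.
move=> pa xm xa; have [wm wa] := teichmullerP pa.
by apply: (teichmuller_uniq hp) => //; apply: (pabs_trans wa); rewrite pabsC.
Qed.

Lemma teichmuller1 : w 1 = 1.
Proof.
apply: teichmuller_eq; rewrite ?expr1n ?subrr ?pabs0 ?pabs_ge0 //.
by rewrite dvdz1 gtn_eqF // prime_gt1.
Qed.

Lemma Euclid_dvdzM (a b : int) : (p %| a * b)%Z = (p %| a)%Z || (p %| b)%Z.
Proof. by rewrite !dvdzE abszM Euclid_dvdM. Qed.

Lemma teichmullerM (a b : int) : w (a * b) = w a * w b.
Proof.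
have [pab|] := boolP (p %| a * b)%Z.
  rewrite /teichmuller pab; move: pab; rewrite Euclid_dvdzM => /orP[] ->;
    first by rewrite mul0r.
  by rewrite mulr0.
move=> pab; move: (pab); rewrite Euclid_dvdzM negb_or => /andP[pa pb].
have [wam wa] := teichmullerP pa; have [wbm wb] := teichmullerP pb.
apply: teichmuller_eq => //; first by rewrite exprMn wam wbm mulr1.
have -> : w a * w b - (a * b)%:~R = w a * (w b - b%:~R) + b%:~R * (w a - a%:~R).
  by rewrite intrM; ring.
have q0 : (0 < totient q)%N by rewrite totient_gt0 teich_modulus_gt0.
apply: pabsD_le; rewrite pabsM; first by rewrite (pabs_root1 q0 wam) mul1r.
by rewrite (pabs_coprime K hp pb) mul1r.
Qed.

Lemma teichmuller_modz (a b : int) : (a = b %[mod q%:Z])%Z -> w a = w b.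
Proof.
move=> ab; have pab : (p %| a)%Z = (p %| b)%Z.
  by apply: negb_inj; rewrite -!(coprimez_teich_modulus hp) (coprimez_modP ab).
have [pa|pa] := boolP (p %| a)%Z; first by rewrite /teichmuller -pab pa.
have pb : ~~ (p %| b)%Z by rewrite -pab.
have [wbm wb] := teichmullerP pb; apply: teichmuller_eq => //.
apply: (pabs_trans wb); move/esym/eqP: ab; rewrite eqz_mod_dvd => /dvdzP[c cE].
by rewrite -rmorphB /= cE intrM pabsM ler_piMl ?pabs_ge0 // pabs_int_le1.
Qed.

Lemma teichmuller_neq0 (a : int) : ~~ (p %| a)%Z -> w a != 0.
Proof.
move=> pa; have [wm _] := teichmullerP pa; apply: contra_eqN wm => /eqP ->.
by rewrite expr0n gtn_eqF ?totient_gt0 ?teich_modulus_gt0 // eq_sym oner_eq0.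
Qed.

Lemma dvdn_gcdMgcd (d f g : nat) : (d %| f * g)%N -> (d %| gcdn d f * gcdn d g)%N.
Proof.
move=> dfg; rewrite muln_gcdr dvdn_gcd dvdn_mull //=.
by rewrite mulnC muln_gcdr dvdn_gcd dvdn_mull //= mulnC.
Qed.

(* Stated for a nontrivial omega^j; otherwise the twist is [chi] itself. *)
Lemma twist_primitive (f : nat) (chi : int -> K) (j : int) (b0 : int) :
  coprime f p -> primitive_dirichlet f chi -> ~~ (p %| b0)%Z -> w b0 ^ j <> 1 ->
  primitive_dirichlet (f * q) (fun a => chi a * (if (p %| a)%Z then 0 else w a ^ j)).
Proof.
move=> cfp hchi pb0 wb0.
have f0 := dirichlet_cond_gt0 hchi; have q0 := teich_modulus_gt0.
have cfq : coprimez f%:Z q%:Z.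
  by rewrite (coprimez_teich_modulus hp) dvdzE /= -prime_coprime // coprime_sym.
have qz : (p %| q%:Z)%Z by rewrite dvdzE /= /teich_modulus; case: eqP => [->|].
split.
- by rewrite muln_gt0 f0.
- move=> a; have wE : w (a + (f * q)%N%:Z) = w a.
    by apply: teichmuller_modz; rewrite PoszM addrC modzMDl.
  rewrite wE rpredDr ?PoszM ?dvdz_mull //; congr (_ * _).
  by apply: (dirichlet_modz hchi); rewrite addrC mulrC modzMDl.
- move=> a b; rewrite (dirichletM hchi) Euclid_dvdzM teichmullerM.
  case: (p %| a)%Z; case: (p %| b)%Z; rewrite /= ?mulr0 ?mul0r //.
  by rewrite expfzMl mulrACA.
- move=> a; rewrite mulf_eq0 negb_or (dirichlet_neq0 hchi) PoszM coprimezMr.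
  rewrite (coprimez_teich_modulus hp); congr (_ && _).
  by case: ifPn => [_|pa]; rewrite ?eqxx // expfz_neq0 ?teichmuller_neq0.
move=> d dfq dlt.
have build b1 b2 : coprimez b1 f%:Z -> ~~ (p %| b2)%Z ->
    (gcdz d%:Z f%:Z %| b1 - 1)%Z -> (gcdz d%:Z q%:Z %| b2 - 1)%Z ->
    chi b1 * w b2 ^ j <> 1 ->
    exists a, [/\ coprimez a (f * q)%N%:Z, (a = 1 %[mod d%:Z])%Z &
      chi a * (if (p %| a)%Z then 0 else w a ^ j) <> 1].
  move=> cb1 pb2 b1d b2d neq; pose a := zchinese f%:Z q%:Z b1 b2.
  have af : (a = b1 %[mod f%:Z])%Z := zchinese_modl cfq b1 b2.
  have aq : (a = b2 %[mod q%:Z])%Z := zchinese_modr cfq b1 b2.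
  have pa : ~~ (p %| a)%Z.
    by rewrite -(coprimez_teich_modulus hp) (coprimez_modP aq)
      (coprimez_teich_modulus hp).
  exists a; split.
  - by rewrite PoszM coprimezMr (coprimez_modP af) cb1 (coprimez_teich_modulus hp).
  - apply/eqP; rewrite eqz_mod_dvd.
    have step (g : nat) (b : int) : (a = b %[mod g%:Z])%Z -> (gcdz d%:Z g%:Z %| b -
      1)%Z ->
        (gcdz d%:Z g%:Z %| a - 1)%Z.
      move/eqP; rewrite eqz_mod_dvd => ag bg.
      by rewrite -(subrK b a) -addrA rpredD // (dvdz_trans _ ag) // dvdz_gcdr.
    apply: dvdz_trans (_ : (gcdz d%:Z f%:Z * gcdz d%:Z q%:Z %| _)%Z).
      by rewrite dvdzE abszM /= dvdn_gcdMgcd.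
    rewrite Gauss_dvdz ?(step _ _ af b1d) ?(step _ _ aq b2d) //.
    move: cfq; rewrite !coprimezE /= => cfq.
    exact: coprime_dvdl (dvdn_gcdr d f) (coprime_dvdr (dvdn_gcdr d q) cfq).
  - by rewrite (negPf pa) (dirichlet_modz hchi af) (teichmuller_modz aq).
have p1 : ~~ (p %| 1)%Z by rewrite dvdz1 gtn_eqF // prime_gt1.
have [fd|fd] := boolP (f %| d)%N.
  have qd : (gcdn d q < q)%N.
    rewrite ltn_neqAle dvdn_leq ?dvdn_gcdr // andbT; apply/eqP => qE.
    move: dlt; rewrite ltnNge dvdn_leq //;
      first by rewrite (dvdn_gt0 _ dfq) // muln_gt0 f0.
    rewrite Gauss_dvd; last by move: cfq; rewrite coprimezE.
    by rewrite fd -qE dvdn_gcdl.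
  apply: (build 1 b0) => //.
  - by rewrite /coprimez gcd1z.
  - by apply: (teich_modulus_proper_dvd hp) => //; apply: dvdn_gcdr.
  - by rewrite (dirichlet1 hchi) mul1r.
have fd' : (gcdn d f < f)%N.
  rewrite ltn_neqAle dvdn_leq ?dvdn_gcdr // andbT; apply: contra fd => /eqP <-.
  exact: dvdn_gcdl.
have [b [cb b1 chib]] := dirichlet_primitive hchi (dvdn_gcdr d f) fd'.
apply: (build b 1) => //.
- by move/eqP: b1; rewrite eqz_mod_dvd.
- by rewrite teichmuller1 exp1rz mulr1.
Qed.

Lemma teich_twist_eq (f c : nat) (chi psi : int -> K) (j : int) :
  primitive_dirichlet f chi -> primitive_dirichlet c psi ->
  (forall a, ~~ (p %| a)%Z -> chi a != 0 -> psi a = chi a * w a ^ j) ->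
  teich_twist chi j = psi.
Proof.
move=> hchi hpsi psiE; rewrite /teich_twist.
set A := [set phi | _]; have : A (get A) by apply: (@getPex _ A); exists psi;
  split=> //; exists c.
case=> [[c' hphi] phiE].
have M0 : (0 < f * p)%N by rewrite muln_gt0 (dirichlet_cond_gt0 hchi) prime_gt0.
apply: (primitive_dirichlet_uniq M0 hphi hpsi _).2 => a.
rewrite PoszM coprimezMr => /andP[caf cap] _ _.
have pa : ~~ (p %| a)%Z.
  by move: cap; rewrite coprimezE /= coprime_sym prime_coprime // dvdzE.
have chia : chi a != 0 by rewrite (dirichlet_neq0 hchi).
by rewrite phiE // psiE.
Qed.

Lemma teich_twist_primitive (f : nat) (chi : int -> K) (j : int) :
  coprime f p -> primitive_dirichlet f chi ->
  (exists c, primitive_dirichlet c (teich_twist chi j)) /\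
  forall a, ~~ (p %| a)%Z -> teich_twist chi j a = chi a * w a ^ j.
Proof.
move=> cfp hchi.
suff [c [psi [hpsi psiE]]] : exists c psi, primitive_dirichlet c psi /\
    forall a, ~~ (p %| a)%Z -> psi a = chi a * w a ^ j.
  have -> : teich_twist chi j = psi by apply: (teich_twist_eq hchi hpsi) => a pa _;
    apply: psiE.
  by split=> //; exists c.
have [[b0 [pb0 wb0]]|triv] := pselect (exists b, ~~ (p %| b)%Z /\ w b ^ j <> 1).
  exists (f * q)%N, (fun a => chi a * (if (p %| a)%Z then 0 else w a ^ j)).
  split; first exact: twist_primitive wb0.
  by move=> a /negPf ->.
exists f, chi; split=> // a pa; have [->|wa] := eqVneq (w a ^ j) 1;
  first by rewrite mulr1.
by case: triv; exists a; split=> //; apply/eqP.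
Qed.

Lemma teich_twistK (f : nat) (chi : int -> K) (j n : int) :
  coprime f p -> primitive_dirichlet f chi -> ((totient q)%:Z %| j - n)%Z ->
  teich_twist (teich_twist chi j) (- n) = chi.
Proof.
move=> cfp hchi mjn; have [[c hpsi] psiE] := teich_twist_primitive j cfp hchi.
apply: (teich_twist_eq hpsi hchi) => a pa _;
  rewrite psiE // -mulrA -expfzDr ?teichmuller_neq0 //.
have [wm _] := teichmullerP pa; case/dvdzP: mjn => t ->.
by rewrite [t * _]mulrC -exprz_exp -exprnP wm exp1rz mulr1.
Qed.

End Twist.

(** * The interpolation argument *)

Lemma dirichlet_sum0_dvd (K : fieldType) (f N : nat) (chi : int -> K) :
  (1 < f)%N -> primitive_dirichlet f chi -> (f %| N)%N ->
  \sum_(k < N) chi (k : nat)%:Z = 0.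
Proof.
move=> f1 hchi /dvdnP[M ->].
rewrite -(big_mkord xpredT (fun k => chi k%:Z)) -(add0n (M * f)%N) sum_nat_blocks.
rewrite add0n big_mkord exchange_big big1 // => i _.
rewrite -[RHS](dirichlet_sum0 f1 hchi); apply: eq_bigr => a _.
by apply: (dirichlet_modz hchi); rewrite PoszD PoszM addrC modzMDl.
Qed.

Section Continuity.
Variables (R : realType) (p : nat) (K : padicClosureType R p).

Lemma within_padicP (A : set K) (L : K -> K) : {within A, continuous L} ->
  forall x, A x -> forall e, 0 < e -> exists2 d : R, 0 < d &
    forall y, A y -> pabs (x - y) < d -> pabs (L x - L y) < e.
Proof.
move=> /subspace_continuousP cL x Ax e e0.
have : nbhs (L x) [set z | pabs (L x - z) < e] by apply/nbhs_padicP; exists e.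
by move=> /(cL x Ax)/nbhs_padicP[d d0 dP]; exists d => // y Ay /dP/(_ Ay).
Qed.

Lemma padic_int_intr (m : int) : padic_int K m%:~R.
Proof. by apply: subset_closure; exists m. Qed.

End Continuity.

Section DirichletSum.
Variables (R : realType) (p : nat) (K : padicClosureType R p).
Hypothesis hp : prime p.
Variables (f N : nat) (chi : int -> K).
Hypotheses (f_gt1 : (1 < f)%N) (hchi : primitive_dirichlet f chi).
Hypotheses (N_gt0 : (0 < N)%N) (hNp : coprime N p) (hfN : (f %| N)%N).

Lemma dirichlet_polygamma_approx (r : int) : exists2 C : R, 0 <= C &
  forall n t j : nat, (0 < n)%N -> n.-1%:Z = - r + (totient (p ^ j.+1) * t)%N%:Z ->
    pabs (\sum_(k < N) chi (k : nat)%:Z * padic_polygamma (r - 1) (k%:R / N%:R : K) -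
          (1 - chi p%:Z * p%:R ^+ n.-1) * (N%:R ^- n.-1 * gen_bernoulli n chi / n%:R))
    <= C * p%:R^-1 ^+ j.
Proof.
have char0 := padic_nat_neq0 K hp.
have pN : ~~ (p %| N)%N by rewrite -prime_coprime // coprime_sym.
exists (\sum_(u < N) pabs (chi (p%:Z * (u : nat)%:Z))) => [|n t j n0 nE].
  by apply: sumr_ge0 => u _; apply: pabs_ge0.
pose P := map_poly (ratr : rat -> K) (bernoulli_poly n).
have dP x : P.[x + 1] - P.[x] = n%:R * x ^+ n.-1 by apply: bernoulli_poly_difference.
pose Q z := (P.[z] - P.[0]) / n%:R.
have reindex (H : nat -> K) : \sum_(k < N) chi (k : nat)%:Z * H k =
    \sum_(u < N) chi (p%:Z * (u : nat)%:Z) * H (p * u %% N)%N.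
  pose F a := chi a * H (absz (a %% N%:Z)%Z).
  transitivity (\sum_(k < N) F (k : nat)%:Z).
    by apply: eq_bigr => k _; rewrite /F modz_nat modn_small.
  rewrite -(sum_modz_mull (b := p%:Z) (F := F)) //.
  - by apply: eq_bigr => u _; rewrite /F -PoszM modz_nat.
  - by rewrite coprimezE /= coprime_sym.
  - move=> x y xy; rewrite /F xy; congr (_ * _); apply: (dirichlet_modz hchi).
    move/eqP: xy; rewrite eqz_mod_dvd => Nxy; apply/eqP; rewrite eqz_mod_dvd.
    by apply: dvdz_trans Nxy; rewrite dvdzE.
have sumQ : \sum_(k < N) chi (k : nat)%:Z * Q (k%:R / N%:R) = N%:R ^- n.-1 *
  gen_bernoulli n chi / n%:R.
  rewrite -(gen_bernoulli_sum char0 f_gt1 hchi n0 N_gt0 hfN) -/P mulKf ?expf_neq0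
    ?char0 //.
  under eq_bigr => k _ do rewrite /Q mulrA mulrBr.
  by rewrite -mulr_suml sumrB -[X in _ - X]mulr_suml (dirichlet_sum0_dvd f_gt1) //
    mul0r subr0.
rewrite -sumQ mulrBl mul1r {1}(reindex (fun k => Q (k%:R / N%:R))).
rewrite (reindex (fun k => padic_polygamma (r - 1) (k%:R / N%:R))).
have -> : chi p%:Z * p%:R ^+ n.-1 * \sum_(k < N) chi (k : nat)%:Z * Q (k%:R / N%:R) =
    \sum_(u < N) chi (p%:Z * (u : nat)%:Z) * (p%:R ^+ n.-1 * Q (u%:R / N%:R)).
  by rewrite mulr_sumr; apply: eq_bigr => u _; rewrite (dirichletM hchi); ring.
rewrite -!sumrB; apply: pabs_sum_le => [|u _].
  by rewrite mulr_ge0 ?pinvX_ge0 // sumr_ge0 // => u _; apply: pabs_ge0.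
rewrite -!mulrBr pabsM ler_pM ?pabs_ge0 //.
  by rewrite (bigD1 u) //= lerDl sumr_ge0 // => v _; apply: pabs_ge0.
apply: polygamma_approx => // l pl; exact: pabs_expz_totient nE.
Qed.

End DirichletSum.

Theorem theorem2p5 (R : realType) (p : nat) (hp : prime p)
    (K : padicClosureType R p) (f : nat) (chi : int -> K)
    (hf1 : (1 < f)%N) (hfp : coprime f p) (hchi : primitive_dirichlet f chi)
    (N : nat) (hN0 : (0 < N)%N) (hNp : coprime N p) (hfN : (f %| N)%N)
    (r : int)
    (L : K -> K) (hL : kubota_leopoldt (teich_twist chi (1 - r)) L) :
  L r%:~R =
    - (1 / N%:R ^ r) *
      \sum_(1 <= k < N) chi k%:Z * padic_polygamma (r - 1) (k%:R / N%:R : K).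
Proof.
have f0 : (0 < f)%N := ltnW hf1.
have chi0 : chi 0 = 0.
  by apply: (dirichlet_eq0 hchi); rewrite /coprimez gcd0z /= eqz_nat gtn_eqF.
have N1 : pabs (N%:R : K) = 1.
  by rewrite pabs_nat_coprime // -prime_coprime // coprime_sym.
set X := \sum_(k < N) chi (k : nat)%:Z * padic_polygamma (r - 1) (k%:R / N%:R : K).
have -> : \sum_(1 <= k < N) chi k%:Z * padic_polygamma (r - 1) (k%:R / N%:R : K) = X.
  rewrite /X -(big_mkord xpredT (fun k => chi k%:Z * padic_polygamma (r - 1) (k%:R /
    N%:R))).
  by rewrite [RHS]big_ltn // chi0 mul0r add0r.
rewrite div1r invr_expz mulNr; apply/eqP; rewrite -subr_eq0 opprK; apply/eqP/pabs_eq0.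
have [psi_prim psiE] := teich_twist_primitive hp (1 - r) hfp hchi.
case: hL; set psi := teich_twist chi (1 - r) in psi_prim psiE * => cL interp.
have psi_neq1 : psi <> fun=> 1.
  move/(congr1 (fun g => g f%:Z)); rewrite psiE; last first.
    by rewrite dvdzE /= -prime_coprime // coprime_sym.
  have -> : chi f%:Z = 0 by rewrite -chi0; apply: (dirichlet_modz hchi);
    rewrite modzz mod0z.
  by move/eqP; rewrite mul0r eq_sym oner_eq0.
have dom (m : int) : (padic_int K `&` [set s | psi = (fun=> 1) -> s <> 1]) m%:~R.
  by split=> [|/psi_neq1 //]; apply: padic_int_intr.
have [C C0 CP] := dirichlet_polygamma_approx hp hf1 hchi hN0 hNp hfN r.
apply/eqP; rewrite eq_le pabs_ge0 andbT; apply/ler_addgt0Pl => e e0; rewrite addr0.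
have [d d0 dP] := within_padicP cL (dom r) e0.
pose B := C + pabs X + 1.
have B0 : 0 < B by rewrite ltr_wpDl // addr_ge0 ?pabs_ge0.
have [j jd] : exists j, (p%:R : R)^-1 ^+ j < Num.min d (e / B).
  by apply: pinvX_lt; rewrite // lt_min d0 divr_gt0.
move: jd; rewrite lt_min => /andP[jd je].
pose t := (totient (teich_modulus p) * (absz r).+1)%N.
pose E := (totient (p ^ j.+1) * t)%N.
have rE : 0 <= - r + E%:Z.
  have : (absz r <= E)%N.
    rewrite (leq_trans (leqnSn _)) // /E /t mulnA leq_pmull // muln_gt0 !totient_gt0.
    by rewrite expn_gt0 prime_gt0 ?teich_modulus_gt0.
  rewrite -lez_nat abszE => /(le_trans (ler_norm r)); rewrite addrC subr_ge0 //.
pose n := (absz (- r + E%:Z)%R).+1.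
have nE : n.-1%:Z = - r + E%:Z by rewrite /= gez0_abs.
have nK : (1 - n%:R : K) = (r - E%:Z)%:~R.
  have -> : r - E%:Z = 1 - n%:Z by rewrite -[n%:Z]/(1 + n.-1%:Z) nE; ring.
  by rewrite rmorphB.
have psinE : teich_twist psi (- n%:Z) = chi.
  apply: (teich_twistK hp hfp hchi).
  have -> : 1 - r - n%:Z = - E%:Z by rewrite -[n%:Z]/(1 + n.-1%:Z) nE; ring.
  by rewrite rpredN /E /t mulnCA PoszM dvdz_mulr.
have := interp n isT; rewrite /= psinE.
move=> Ln; have {CP} := CP n t j isT nE.
set Y := _ * (_ * _ / _) => XY.
have LY : L (1 - n%:R) = - (N%:R ^+ n.-1 * Y).
  have Nn : N%:R ^+ n.-1 != 0 :> K by rewrite expf_neq0 // padic_nat_neq0.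
  by rewrite Ln /Y -[in RHS]mulrA [in RHS]mulrCA mulVKf // mulNr.
have -> : L r%:~R + N%:R ^ (- r) * X = (L r%:~R - L (1 - n%:R)) +
    ((N%:R ^ (- r) - N%:R ^+ n.-1) * X + N%:R ^+ n.-1 * (X - Y)).
  by rewrite LY; ring.
have small : B * p%:R^-1 ^+ j <= e by move: je; rewrite ltr_pdivlMr // mulrC => /ltW.
have j0 : 0 <= (p%:R : R)^-1 ^+ j := pinvX_ge0 R p j.
apply: pabsD_le.
  apply/ltW; rewrite nK; apply: dP; first exact: dom.
  rewrite -rmorphB /= opprB addrCA subrr addr0 -pmulrn.
  apply: le_lt_trans jd; rewrite /E totient_pfactor // -mulnA mulnCA natrM pabsM natrX.
  by rewrite pabs_expp ler_piMr // pabs_nat_le1.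
apply: le_trans small; apply: pabsD_le; rewrite pabsM.
  rewrite mulrC ler_pM ?pabs_ge0 //.
    by rewrite /B -addrA [C + _]addrC -addrA lerDl addr_ge0.
  by apply: pabs_expz_totient nE; rewrite // -prime_coprime // coprime_sym.
rewrite pabsX N1 expr1n mul1r; apply: le_trans XY _.
by rewrite ler_wpM2r // /B -addrA lerDl addr_ge0 ?pabs_ge0.
Qed.
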